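(* For every single-valued pointed problem $F:\subseteq\mathbb N^{\mathbb N}\to\mathbb N^{\mathbb N}$ we have $F^\infty\equiv_{\mathrm{sW}}F^\omega\equiv_{\mathrm{sW}}\widehat{F^\diamond}$.
   Context: Problems. A partial function $F:\subseteq\mathbb N^{\mathbb N}\to\mathbb N^{\mathbb N}$ is computable if there is a computable monotone (w.r.t. the prefix order) word function $\varphi:\mathbb N^*\to\mathbb N^*$ with $F(p)=\sup_{w\sqsubseteq p}\varphi(w)$ for all $p\in\mathrm{dom}(F)$. For represented spaces $(X,\delta_X),(Y,\delta_Y)$ ($\delta_X:\subseteq\mathbb N^{\mathbb N}\to X$ surjective) and a partial multivalued $f:\subseteq X\rightrightarrows Y$, $F:\subseteq\mathbb N^{\mathbb N}\to\mathbb N^{\mathbb N}$ is a realizer, $F\vdash f$, if $\delta_YF(p)\in f\delta_X(p)$ for all $p\in\mathrm{dom}(f\delta_X)$. A problem is a multivalued function with a realizer. Composition: $g\circ f(x)=\{z:(\exists y\in f(x))\,z\in g(y)\}$ with $\mathrm{dom}(g\circ f)=\{x\in\mathrm{dom}(f):f(x)\subseteq\mathrm{dom}(g)\}$. Tupling. $\langle q,p\rangle:=q(0)p(0)q(1)p(1)\dots$; $\langle p_0,p_1,\dots\rangle$ is the standard countable tupling, e.g. $\langle p_0,p_1,\dots\rangle(\langle i,j\rangle)=p_i(j)$, and $\langle q_0,\dots,q_k\rangle$ is a standard finite tupling. $\langle\mathrm{id}\times f\rangle$ is the problem $\langle q,p\rangle\mapsto\{\langle q,r\rangle:r\in f(p)\}$.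 Universal function. $\Phi$ is a fixed standard total representation of a set of continuous partial functions on $\mathbb N^{\mathbb N}$ (with natural domains), where a name $q$ encodes the graph of a monotone word function approximating $\Phi_q$; $\mathsf U_q:=\Phi_q$, and $\mathsf U\langle q,p\rangle:=\mathsf U_q(p)$ is a computable partial function. The smn-theorem holds: for every computable (continuous) $F:\subseteq\mathbb N^{\mathbb N}\to\mathbb N^{\mathbb N}$ there is a total computable (continuous) $S$ with $\mathsf U_{S(q)}(p)=F\langle q,p\rangle$ for all $\langle q,p\rangle\in\mathrm{dom}(F)$. The names $q$ allow the digits $0,1,2$ as dummy symbols: adding or removing them does not change $\mathsf U_q$. Operators, for $f:\subseteq\mathbb N^{\mathbb N}\rightrightarrows\mathbb N^{\mathbb N}$. Put $L_f:=\mathsf U\circ\langle\mathrm{id}\times f\rangle$. Infinite loop: $f^\infty(q_0):=\{\langle q_0,q_1,\dots\rangle:(\forall i)\ q_{i+1}\in L_f(q_i)\}$, with $\mathrm{dom}(f^\infty)$ the set of $q_0$ such that $A_0:=\{q_0\}\subseteq\mathrm{dom}(L_f)$ and $A_{i+1}:=L_f(A_i)\subseteq\mathrm{dom}(L_f)$ for all $i$. Diamond: a finite run is $\langle q_0,\dots,q_k\rangle$ with $q_{i+1}\in L_f(q_i)$ for all $i<k$; an infinite run is $\langle q_0,q_1,\dots\rangle$ with this for all $i$. A finite run is successful if $q_k(0)=0$ and $q_i(0)\ne0$ for all $i<k$; it stalls if $q_k\notin\mathrm{dom}(L_f)$ and $q_i(0)\ne0$ for all $i\le k$; an infinite run is unsuccessful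 if $q_i(0)\ne0$ for all $i$. $f^\diamond(q_0)$ is the set of all $q_k$ such that there are $q_1,\dots,q_{k-1}$ with $\langle q_0,\dots,q_k\rangle$ a successful finite run; $\mathrm{dom}(f^\diamond)$ is the set of $q_0$ such that no run starting with $q_0$ stalls or is infinite and unsuccessful. Omega: $f^{[0]}:=\mathrm{id}$, $f^{[1]}:=\langle\mathrm{id}\times f\rangle$, $f^{[n+1]}:=\langle\mathrm{id}\times f\rangle\circ\mathsf U\circ f^{[n]}$ for $n\ge1$, and $f^\omega(p):=\langle f^{[0]}(p),f^{[1]}(p),f^{[2]}(p),\dots\rangle=\{\langle r_0,r_1,\dots\rangle:(\forall n)\ r_n\in f^{[n]}(p)\}$ for all $p$ with $p\in\mathrm{dom}(f^{[n]})$ for all $n$. Parallelization: for $g:\subseteq X\rightrightarrows Y$, $\widehat g:\subseteq X^{\mathbb N}\rightrightarrows Y^{\mathbb N}$, $(x_i)_i\mapsto\prod_ig(x_i)$. Reducibilities. $f\le_{\mathrm W}g$ if there are computable $H,K:\subseteq\mathbb N^{\mathbb N}\to\mathbb N^{\mathbb N}$ with $H\langle\mathrm{id},GK\rangle\vdash f$ whenever $G\vdash g$; $f\le_{\mathrm{sW}}g$ if there are computable $H,K$ with $HGK\vdash f$ whenever $G\vdash g$; $\equiv_{\mathrm{sW}}$ is the induced equivalence. A problem $f$ is pointed if $\mathrm{id}\le_{\mathrm W}f$ for the identity $\mathrm{id}$ on $\mathbb N^{\mathbb N}$, i.e. if $f$ has a computable input. *)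

(* Defs.v *)
From Stdlib Require Import Arith List Lia.
From Stdlib Require Import Classical FunctionalExtensionality IndefiniteDescription.
From Stdlib Require Fin Vector Cantor.
Import ListNotations.

Set Implicit Arguments.
Unset Strict Implicit.
Unset Printing Implicit Defensive.

(* The total recursive functions of each arity (Kleene): minimization is only
   applied to regular functions, i.e. when a zero exists for all arguments. *)
Inductive recursive : forall k : nat, (Vector.t nat k -> nat) -> Prop :=
| rec_zero k : @recursive k (fun _ => 0)
| rec_succ : @recursive 1 (fun v => S (Vector.hd v))
| rec_proj k (i : Fin.t k) : @recursive k (fun v => Vector.nth v i)
| rec_comp k m (f : Vector.t nat m -> nat) (g : Vector.t (Vector.t nat k -> nat) m) :
    @recursive m f ->
    (forall i : Fin.t m, @recursive k (Vector.nth g i)) ->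
    @recursive k (fun v => f (Vector.map (fun h => h v) g))
| rec_prim k (f : Vector.t nat k -> nat) (g : Vector.t nat (S (S k)) -> nat) :
    @recursive k f -> @recursive (S (S k)) g ->
    @recursive (S k) (fun v =>
      nat_rec (fun _ => nat) (f (Vector.tl v))
        (fun n r => g (Vector.cons nat n (S k) (Vector.cons nat r k (Vector.tl v))))
        (Vector.hd v))
| rec_mu k (f : Vector.t nat (S k) -> nat) (g : Vector.t nat k -> nat) :
    @recursive (S k) f ->
    (forall v, f (Vector.cons nat (g v) k v) = 0 /\
       forall m, m < g v -> f (Vector.cons nat m k v) <> 0) ->
    @recursive k g.

Fixpoint code (w : list nat) : nat :=
  match w with
  | [] => 0
  | a :: w' => S (Cantor.to_nat (a, code w'))
  end.

Definition computable_word_fun (phi : list nat -> list nat) : Prop :=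
  exists f : Vector.t nat 1 -> nat, recursive f /\
    forall w, f (Vector.cons nat (code w) 0 (Vector.nil nat)) = code (phi w).

Definition baire : Type := nat -> nat.

Definition prefix (u v : list nat) : Prop := exists t, v = u ++ t.

Definition initial (w : list nat) (p : baire) : Prop :=
  w = map p (seq 0 (length w)).

Definition monotone (phi : list nat -> list nat) : Prop :=
  forall u v, prefix u v -> prefix (phi u) (phi v).

(* [r] is the supremum of the words [phi w] for [w] ranging over the finite
   initial segments of [p]; this supremum has to be an infinite sequence. *)
Definition sup_along (phi : list nat -> list nat) (p r : baire) : Prop :=
  (forall w, initial w p -> initial (phi w) r) /\
  (forall n, exists w, initial w p /\ n <= length (phi w)).

(* <q,p> = q(0) p(0) q(1) p(1) ... *)
Definition pair (q p : baire) : baire :=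
  fun n => if Nat.even n then q (Nat.div2 n) else p (Nat.div2 n).

(* <p_0, p_1, ...> (<i,j>) = p_i(j), with <i,j> the Cantor pairing. *)
Definition tuple (ps : nat -> baire) : baire :=
  fun n => let (i, j) := Cantor.of_nat n in ps i j.

(* A relation [f] is read as the partial multivalued map with
   f(x) = {y | f x y}, whose domain consists of the x with f(x) nonempty. *)
Definition dom {X Y : Type} (f : X -> Y -> Prop) (x : X) : Prop :=
  exists y, f x y.

Definition single_valued {X Y : Type} (f : X -> Y -> Prop) : Prop :=
  forall x y y', f x y -> f x y' -> y = y'.

Definition comp {X Y Z : Type} (g : Y -> Z -> Prop) (f : X -> Y -> Prop)
    (x : X) (z : Z) : Prop :=
  (forall y, f x y -> dom g y) /\ exists y, f x y /\ g y z.

(* This forces [F] to be single-valued. *)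
Definition computable (F : baire -> baire -> Prop) : Prop :=
  exists phi, computable_word_fun phi /\ monotone phi /\
    forall p r, F p r -> sup_along phi p r.

Record rep_space : Type := RepSpace {
  carrier :> Type;
  delta : baire -> carrier -> Prop;
  delta_single_valued : single_valued delta;
  delta_surjective : forall x, exists p, delta p x
}.

Definition mvf (X Y : rep_space) : Type := X -> Y -> Prop.

Definition Baire : rep_space.
Proof.
  refine (@RepSpace baire (fun p x => p = x) _ _).
  - intros p x x' <- <-; reflexivity.
  - intros x; exists x; reflexivity.
Defined.

Lemma tuple_inj ps ps' : tuple ps = tuple ps' -> ps = ps'.
Proof.
  intros H; extensionality i; extensionality j.
  apply (f_equal (fun h => h (Cantor.to_nat (i, j)))) in H.
  unfold tuple in H; now rewrite Cantor.cancel_of_to in H.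
Qed.

(* X^N: the names of (x_i)_i are the <p_0, p_1, ...> with p_i a name of x_i. *)
Definition seq_space (X : rep_space) : rep_space.
Proof.
  refine (@RepSpace (nat -> X)
    (fun p x => exists ps, p = tuple ps /\ forall i, delta (ps i) (x i)) _ _).
  - intros p x x' [ps [-> H]] [ps' [E H']].
    apply tuple_inj in E; subst ps'; extensionality i.
    exact (delta_single_valued (H i) (H' i)).
  - intros x.
    destruct (functional_choice _ (fun i => delta_surjective (x i))) as [ps Hps].
    exists (tuple ps), ps; split; [reflexivity | exact Hps].
Defined.

Definition realizes {X Y : rep_space} (G : baire -> baire -> Prop) (f : mvf X Y) : Prop :=
  single_valued G /\
  forall p x, delta p x -> dom f x ->
    exists r y, G p r /\ delta r y /\ f x y.

Definition is_problem {X Y : rep_space} (f : mvf X Y) : Prop :=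
  exists G, realizes G f.

Definition parallelization {X Y : rep_space} (g : mvf X Y) :
    mvf (seq_space X) (seq_space Y) :=
  fun x y => forall i, g (x i) (y i).

(* p |-> <p, G(p)> *)
Definition pair_id (G : baire -> baire -> Prop) (p z : baire) : Prop :=
  exists r, G p r /\ z = pair p r.

Definition le_W {X Y Z V : rep_space} (f : mvf X Y) (g : mvf Z V) : Prop :=
  exists H K, computable H /\ computable K /\
    forall G, realizes G g -> realizes (comp H (pair_id (comp G K))) f.

Definition le_sW {X Y Z V : rep_space} (f : mvf X Y) (g : mvf Z V) : Prop :=
  exists H K, computable H /\ computable K /\
    forall G, realizes G g -> realizes (comp H (comp G K)) f.

Definition equiv_sW {X Y Z V : rep_space} (f : mvf X Y) (g : mvf Z V) : Prop :=
  le_sW f g /\ le_sW g f.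

Definition id_Baire : mvf Baire Baire := fun p r => p = r.

Definition pointed {X Y : rep_space} (f : mvf X Y) : Prop := le_W id_Baire f.

(* The digits 0, 1, 2 of a name are dummies; every other digit encodes exactly
   one pair (u,v) of words. *)
Definition lists (q : baire) (u v : list nat) : Prop :=
  exists n, q n = 3 + Cantor.to_nat (code u, code v).

(* [Phi q p r] means Phi_q(p) = r: the words [v] listed together with some
   initial segment [u] of [p] have the infinite sequence [r] as supremum.  If
   [q] lists the graph of a monotone word function phi (or a part of it which
   determines phi), this is r = sup phi(w), with the natural domain.  Every [q]
   is a name; if it lists incompatible words for [p], then Phi_q(p) is
   undefined. *)
Definition Phi (q p r : baire) : Prop :=
  (forall u v, lists q u v -> initial u p -> initial v r) /\
  (forall n, exists u v, lists q u v /\ initial u p /\ n <= length v).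

Definition U : mvf Baire Baire :=
  fun x r => exists q p, x = pair q p /\ Phi q p r.

(* <q,p> |-> {<q,r> | r in f(p)} *)
Definition id_times (f : mvf Baire Baire) : mvf Baire Baire :=
  fun x z => exists q p r, x = pair q p /\ f p r /\ z = pair q r.

Definition L (f : mvf Baire Baire) : mvf Baire Baire := comp U (id_times f).

(* The sets A_i, with A_{i+1} = L_f(A_i). *)
Fixpoint stage (f : mvf Baire Baire) (q0 : baire) (i : nat) : baire -> Prop :=
  match i with
  | 0 => fun r => r = q0
  | S i' => fun r => exists q, stage f q0 i' q /\ L f q r
  end.

Definition inf_loop_dom (f : mvf Baire Baire) (q0 : baire) : Prop :=
  forall i q, stage f q0 i q -> dom (L f) q.

Definition inf_loop (f : mvf Baire Baire) : mvf Baire Baire :=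
  fun q0 r => inf_loop_dom f q0 /\
    exists q : nat -> baire,
      q 0 = q0 /\ (forall i, L f (q i) (q (S i))) /\ r = tuple q.

(* A finite run <q_0, ..., q_k> is given by [k] and a sequence [q] of which
   only the terms up to index [k] matter. *)
Definition finite_run (f : mvf Baire Baire) (k : nat) (q : nat -> baire) : Prop :=
  forall i, i < k -> L f (q i) (q (S i)).

Definition infinite_run (f : mvf Baire Baire) (q : nat -> baire) : Prop :=
  forall i, L f (q i) (q (S i)).

Definition successful (f : mvf Baire Baire) (k : nat) (q : nat -> baire) : Prop :=
  finite_run f k q /\ q k 0 = 0 /\ forall i, i < k -> q i 0 <> 0.

Definition stalls (f : mvf Baire Baire) (k : nat) (q : nat -> baire) : Prop :=
  finite_run f k q /\ ~ dom (L f) (q k) /\ forall i, i <= k -> q i 0 <> 0.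

Definition unsuccessful (f : mvf Baire Baire) (q : nat -> baire) : Prop :=
  infinite_run f q /\ forall i, q i 0 <> 0.

Definition diamond_dom (f : mvf Baire Baire) (q0 : baire) : Prop :=
  (forall k q, q 0 = q0 -> ~ stalls f k q) /\
  (forall q, q 0 = q0 -> ~ unsuccessful f q).

Definition diamond (f : mvf Baire Baire) : mvf Baire Baire :=
  fun q0 r => diamond_dom f q0 /\
    exists k q, q 0 = q0 /\ successful f k q /\ r = q k.

(* f^[n]; note that f^[1] = <id x f> does not involve U. *)
Fixpoint iterate (f : mvf Baire Baire) (n : nat) : mvf Baire Baire :=
  match n with
  | 0 => id_Baire
  | S m => match m with
           | 0 => id_times f
           | S _ => comp (id_times f) (comp U (iterate f m))
           end
  end.

Definition omega (f : mvf Baire Baire) : mvf Baire Baire :=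
  fun p s => exists r : nat -> baire, (forall n, iterate f n p (r n)) /\ s = tuple r.

Lemma dependent_choice (A : Type) (P : A -> Prop) (R : A -> A -> Prop) (a : A) :
  P a -> (forall x, P x -> exists y, R x y /\ P y) ->
  exists s : nat -> A, s 0 = a /\ forall n, P (s n) /\ R (s n) (s (S n)).
Proof.
  intros Ha step.
  destruct (functional_choice (fun x y => P x -> R x y /\ P y)) as [h Hh].
  { intros x. destruct (classic (P x)) as [Hx | Hx].
    - destruct (step x Hx) as [y Hy]; exists y; tauto.
    - exists x; tauto. }
  set (s := fun n => nat_rect (fun _ => A) a (fun _ x => h x) n).
  assert (HP : forall n, P (s n)).
  { induction n as [| n IH]; [exact Ha | exact (proj2 (Hh _ IH))]. }
  exists s; split; [reflexivity |].
  intros n; split; [apply HP | exact (proj1 (Hh _ (HP n)))].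
Qed.

(* The domain of [inf_loop f] in the sense of [dom] is the prescribed one. *)
Lemma dom_inf_loop f q0 : dom (inf_loop f) q0 <-> inf_loop_dom f q0.
Proof.
  split; [intros [r [H _]]; exact H | intros H].
  destruct (@dependent_choice baire (fun x => exists i, stage f q0 i x) (L f) q0)
    as [q [Hq0 Hq]].
  - exists 0; reflexivity.
  - intros x [i Hi]. destruct (H i x Hi) as [y Hy].
    exists y; split; [exact Hy | exists (S i), x; split; assumption].
  - exists (tuple q); split; [exact H |].
    exists q; split; [exact Hq0 | split; [intros i; apply Hq | reflexivity]].
Qed.

Lemma dom_diamond f q0 : dom (diamond f) q0 <-> diamond_dom f q0.
Proof.
  split; [intros [r [H _]]; exact H | intros H].
  apply NNPP; intros N.
  assert (NS : forall k q, q 0 = q0 -> ~ successful f k q).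
  { intros k q E Hs; apply N; exists (q k); split; [exact H | exists k, q; auto]. }
  destruct H as [Hst Hinf].
  set (P := fun x : baire => exists k q, q 0 = q0 /\ finite_run f k q /\
              (forall i, i <= k -> q i 0 <> 0) /\ x = q k).
  destruct (@dependent_choice baire P (L f) q0) as [q [E Hq]].
  - exists 0, (fun _ => q0).
    assert (R0 : finite_run f 0 (fun _ => q0)) by (intros i Hi; lia).
    split; [reflexivity | split; [exact R0 | split; [| reflexivity]]].
    intros i _ Z; apply (NS 0 (fun _ => q0) eq_refl).
    split; [exact R0 | split; [exact Z | intros j Hj; lia]].
  - intros x [k [q [E [Hrun [Hnz ->]]]]].
    destruct (classic (dom (L f) (q k))) as [[y Hy] | D];
      [| exfalso; apply (Hst k q E); split; auto].
    set (q' := fun i => if i <=? k then q i else y).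
    assert (Hlo : forall i, i <= k -> q' i = q i).
    { intros i Hi; unfold q'; now rewrite (proj2 (Nat.leb_le i k) Hi). }
    assert (Hhi : q' (S k) = y).
    { unfold q'; now rewrite (proj2 (Nat.leb_gt (S k) k) (Nat.lt_succ_diag_r k)). }
    assert (Hrun' : finite_run f (S k) q').
    { intros i Hi. destruct (Nat.eq_dec i k) as [-> | Hne].
      - rewrite Hhi, Hlo by lia; exact Hy.
      - rewrite !Hlo by lia; apply Hrun; lia. }
    assert (E' : q' 0 = q0) by (rewrite Hlo by lia; exact E).
    assert (Hnz' : forall i, i < S k -> q' i 0 <> 0).
    { intros i Hi; rewrite Hlo by lia; apply Hnz; lia. }
    exists y; split; [exact Hy |]. exists (S k), q'.
    split; [exact E' | split; [exact Hrun' | split; [| symmetry; exact Hhi]]].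
    intros i Hi. destruct (Nat.eq_dec i (S k)) as [-> | Hne]; [| apply Hnz'; lia].
    intros Z; apply (NS (S k) q' E'); split; auto; split; auto.
  - apply (Hinf q E); split; intros i; [apply Hq |].
    destruct (proj1 (Hq i)) as [k [s [_ [_ [Hnz ->]]]]]; apply Hnz; lia.
Qed.

(* Main.v *)
(* For single-valued [f] the three operators all describe the deterministic run q_0, q_1, ... of
   [L f], so it suffices to reduce them to each other in a cycle.

   - [inf_loop f] to [omega f]: apply [U] to the results of the calls of [f].
   - [omega f] to the parallelized diamond: by the recursion theorem there is a program with a
     counter that runs [L f] until the counter is 0 and then returns the result of the last call;
     one instance of the diamond is used for each component of [omega f].
   - the parallelized diamond to [inf_loop f]: a single loop dovetails all instances, making one
     step of one instance per pass. Pointedness provides an input for [f] in the passes that meet an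
     instance that has already stopped. The states of all instances can be read off the programs
     that the loop goes through, since names of programs are made to store their parameters. *)
Require Import Defs.
From Stdlib Require Import Arith List Lia.
From Stdlib Require Import FunctionalExtensionality IndefiniteDescription.
From Stdlib Require Fin Vector Cantor.
Import ListNotations.

Set Implicit Arguments.
Unset Strict Implicit.
Unset Printing Implicit Defensive.

Local Arguments Cantor.to_nat : simpl never.
Local Arguments Cantor.of_nat : simpl never.

(** * Recursive functions *)

(** All reductions are strong: the outer map sees only the answer and not the original input, so
    whatever it needs at the end has to survive inside the states of the simulated run. A state is a
    program paired with an input for [f], and one pass of [L f] merely feeds the answer of [f] to
    the program. The program itself must build the next state, including the name of the next
    program. The recursion theorem provides this self-reference without computing a fixed point: a
    name made from [g] and [x] hands [g] to its own body, which can then form the names for [g] and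
    any other [x']. The diamond stops at a first digit 0. Hence names of programs are built so as
    not to begin with 0, while returned results are preceded by the zero sequence. Computability has
    to be traced back to Kleene's recursive functions. Two devices keep this manageable: functions
    on coded data types, and a digit-by-digit criterion in which the approximations need not be
    monotone, the monotone word function being constructed once and for all. *)

Lemma recursive_ext k (f g : Vector.t nat k -> nat) :
  recursive f -> (forall v, f v = g v) -> recursive g.
Proof. intros Hf E; now rewrite <- (functional_extensionality _ _ E). Qed.

Definition arg0 k (v : Vector.t nat (S k)) : nat := Vector.hd v.
Definition arg1 k (v : Vector.t nat (S (S k))) : nat := Vector.hd (Vector.tl v).
Definition arg2 k (v : Vector.t nat (S (S (S k)))) : nat :=
  Vector.hd (Vector.tl (Vector.tl v)).

Lemma recursive_arg0 k : recursive (@arg0 k).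
Proof.
  apply recursive_ext with (1 := rec_proj (@Fin.F1 k)).
  intros v; now rewrite (Vector.eta v).
Qed.

Lemma recursive_arg1 k : recursive (@arg1 k).
Proof.
  apply recursive_ext with (1 := rec_proj (Fin.FS (@Fin.F1 k))).
  intros v; now rewrite (Vector.eta v), (Vector.eta (Vector.tl v)).
Qed.

Lemma recursive_arg2 k : recursive (@arg2 k).
Proof.
  apply recursive_ext with (1 := rec_proj (Fin.FS (Fin.FS (@Fin.F1 k)))).
  intros v; now rewrite (Vector.eta v), (Vector.eta (Vector.tl v)),
    (Vector.eta (Vector.tl (Vector.tl v))).
Qed.

Definition recf (f : nat -> nat) : Prop := recursive (fun v : Vector.t nat 1 => f (arg0 v)).
Definition recf2 (f : nat -> nat -> nat) : Prop :=
  recursive (fun v : Vector.t nat 2 => f (arg0 v) (arg1 v)).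

Lemma recursive_comp1 k f (g : Vector.t nat k -> nat) :
  recf f -> recursive g -> recursive (fun v => f (g v)).
Proof.
  intros Hf Hg.
  apply (rec_comp (g := Vector.cons _ g _ (Vector.nil _)) Hf).
  intros i; apply (Fin.caseS' i); [exact Hg | intros j; inversion j].
Qed.

Lemma recursive_comp2 k f (g h : Vector.t nat k -> nat) :
  recf2 f -> recursive g -> recursive h -> recursive (fun v => f (g v) (h v)).
Proof.
  intros Hf Hg Hh.
  apply (rec_comp (g := Vector.cons _ g _ (Vector.cons _ h _ (Vector.nil _))) Hf).
  intros i; apply (Fin.caseS' i); [exact Hg | intros j].
  apply (Fin.caseS' j); [exact Hh | intros l; inversion l].
Qed.

Lemma recursive_const k c : recursive (fun _ : Vector.t nat k => c).
Proof.
  induction c as [| c IH]; [apply rec_zero |].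
  exact (recursive_comp1 (f := S) rec_succ IH).
Qed.

Lemma recf2_prec (a : nat -> nat) (s : nat -> nat -> nat -> nat) :
  recf a ->
  recursive (fun v : Vector.t nat 3 => s (arg0 v) (arg1 v) (arg2 v)) ->
  recf2 (fun n x => nat_rec (fun _ => nat) (a x) (fun i r => s i r x) n).
Proof. intros Ha Hs; exact (rec_prim Ha Hs). Qed.

Lemma recf_prec0 c (s : nat -> nat -> nat) :
  recf2 s -> recf (fun n => nat_rec (fun _ => nat) c s n).
Proof. intros Hs; exact (rec_prim (recursive_const 0 c) Hs). Qed.

Lemma recf_comp f g : recf f -> recf g -> recf (fun x => f (g x)).
Proof. exact (@recursive_comp1 1 f (fun v => g (arg0 v))). Qed.

Lemma recf_comp2 f g h : recf2 f -> recf g -> recf h -> recf (fun x => f (g x) (h x)).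
Proof. exact (@recursive_comp2 1 f (fun v => g (arg0 v)) (fun v => h (arg0 v))). Qed.

Lemma recf2_swap f : recf2 f -> recf2 (fun x y => f y x).
Proof.
  intros Hf; exact (recursive_comp2 Hf (recursive_arg1 0) (recursive_arg0 1)).
Qed.

Lemma recf2_add : recf2 Nat.add.
Proof.
  refine (recursive_ext (recf2_prec (a := fun x => x) (s := fun _ r _ => S r) _ _) _).
  - apply recursive_arg0.
  - exact (recursive_comp1 (f := S) rec_succ (recursive_arg1 1)).
  - intros v; simpl; induction (arg0 v); simpl; auto.
Qed.

Lemma recf_pred : recf pred.
Proof.
  refine (recursive_ext (recf_prec0 0 (s := fun i _ => i) (recursive_arg0 1)) _).
  intros v; now destruct (arg0 v).
Qed.

Lemma recf2_sub : recf2 Nat.sub.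
Proof.
  apply (@recf2_swap (fun y x => x - y)).
  refine (recursive_ext (recf2_prec (a := fun x => x) (s := fun _ r _ => pred r) _ _) _).
  - apply recursive_arg0.
  - exact (recursive_comp1 recf_pred (recursive_arg1 1)).
  - intros v; simpl; induction (arg0 v); simpl; lia.
Qed.

Definition triangle (n : nat) : nat := nat_rec (fun _ => nat) 0 (fun i m => S i + m) n.

Lemma recf_triangle : recf triangle.
Proof.
  apply (@recf_prec0 0 (fun i m => S i + m)).
  apply (@recursive_comp2 2 Nat.add); [apply recf2_add | | apply recursive_arg1].
  exact (recursive_comp1 (f := S) rec_succ (recursive_arg0 1)).
Qed.

Local Notation npair x y := (Cantor.to_nat (x, y)).
Local Notation nfst n := (fst (Cantor.of_nat n)).
Local Notation nsnd n := (snd (Cantor.of_nat n)).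

Lemma npair_triangle x y : npair x y = y + triangle (y + x).
Proof. reflexivity. Qed.

Lemma recf_npair f g : recf f -> recf g -> recf (fun x => npair (f x) (g x)).
Proof.
  intros Hf Hg.
  apply (recf_comp2 recf2_add Hg).
  apply (recf_comp recf_triangle), (recf_comp2 recf2_add Hg Hf).
Qed.

Lemma triangle_mono m n : m <= n -> triangle m <= triangle n.
Proof. induction 1 as [| n _ IH]; simpl in *; lia. Qed.

(* The diagonal of [n] is the least [s] with [n < triangle (S s)]. *)
Lemma recf_diagonal : recf (fun n => nfst n + nsnd n).
Proof.
  apply (@rec_mu 1 (fun v => S (arg1 v) - triangle (S (arg0 v)))).
  - apply (@recursive_comp2 2 Nat.sub); [apply recf2_sub | |].
    + exact (recursive_comp1 (f := S) rec_succ (recursive_arg1 0)).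
    + apply (recursive_comp1 recf_triangle).
      exact (recursive_comp1 (f := S) rec_succ (recursive_arg0 1)).
  - intros v; unfold arg1; simpl; fold (arg0 v); generalize (arg0 v); intros n.
    pose proof (Cantor.cancel_to_of n) as E.
    destruct (Cantor.of_nat n) as [x y]; simpl fst in *; simpl snd in *.
    rewrite npair_triangle in E; unfold arg0; simpl Vector.hd.
    rewrite (Nat.add_comm x y); split.
    + change (triangle (S (y + x))) with (S (y + x) + triangle (y + x)); lia.
    + intros m Hm; assert (H : triangle (S m) <= triangle (y + x)) by (apply triangle_mono; lia).
      change (triangle (S m)) with (S m + triangle m) in H; lia.
Qed.

Lemma recf_nsnd : recf (fun n => nsnd n).
Proof.
  refine (recursive_ext (recf_comp2 (f := Nat.sub) (g := fun n => n)
    (h := fun n => triangle (nfst n + nsnd n)) recf2_sub (recursive_arg0 0)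
    (recf_comp recf_triangle recf_diagonal)) _).
  intros v; generalize (arg0 v); intros n; simpl.
  pose proof (Cantor.cancel_to_of n) as E; destruct (Cantor.of_nat n) as [x y].
  rewrite npair_triangle in E; simpl; rewrite (Nat.add_comm x y); lia.
Qed.

Lemma recf_nfst : recf (fun n => nfst n).
Proof.
  refine (recursive_ext (recf_comp2 (f := Nat.sub) recf2_sub
    recf_diagonal recf_nsnd) _).
  intros v; simpl; lia.
Qed.

(** Packing parameter, index and previous value into one Cantor pair lets the closure lemmas that
    follow deal with unary functions only. *)
Lemma recf_prec (a s n : nat -> nat) :
  recf a -> recf s -> recf n ->
  recf (fun x => nat_rec (fun _ => nat) (a x) (fun i r => s (npair x (npair i r))) (n x)).
Proof.
  intros Ha Hs Hn.
  assert (H2 : forall k (f g : Vector.t nat k -> nat),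
    recursive f -> recursive g -> recursive (fun v => npair (f v) (g v))).
  { intros k f g Hf Hg; apply (recursive_comp2 recf2_add Hg).
    apply (recursive_comp1 recf_triangle), (recursive_comp2 recf2_add Hg Hf). }
  apply (recf_comp2 (f := fun n x => nat_rec (fun _ => nat) (a x)
    (fun i r => s (npair x (npair i r))) n)); [| exact Hn | apply recursive_arg0].
  apply (recf2_prec (s := fun i r x => s (npair x (npair i r))) Ha).
  apply (recursive_comp1 Hs).
  apply H2; [apply recursive_arg2 |].
  apply H2; [apply recursive_arg0 | apply recursive_arg1].
Qed.

Lemma recf_id : recf (fun x => x).
Proof. apply recursive_arg0. Qed.

Lemma recf_const c : recf (fun _ => c).
Proof. exact (recursive_const 1 c). Qed.

Lemma recf_S : recf S.
Proof. exact rec_succ. Qed.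

(** * Recursive functions between coded data types *)

Class Coded (A : Type) := enc : A -> nat.

#[local] Instance Coded_nat : Coded nat := fun n => n.
#[local] Instance Coded_bool : Coded bool := fun b => if b then 1 else 0.
#[local] Instance Coded_prod A B (cA : Coded A) (cB : Coded B) : Coded (A * B) :=
  fun p => npair (enc (fst p)) (enc (snd p)).
#[local] Instance Coded_option A (cA : Coded A) : Coded (option A) :=
  fun o => match o with None => 0 | Some a => S (enc a) end.
(** Made to agree with [code] on words, so that [crec] on [list nat] is the required notion of
    computable word function. *)
#[local] Instance Coded_list A (cA : Coded A) : Coded (list A) :=
  fix enc_list l := match l with [] => 0 | a :: l' => S (npair (enc a) (enc_list l')) end.

Definition crec A B {cA : Coded A} {cB : Coded B} (f : A -> B) : Prop :=
  exists f', recf f' /\ forall a, f' (enc a) = enc (f a).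

Definition crec2 A B C {cA : Coded A} {cB : Coded B} {cC : Coded C} (f : A -> B -> C) : Prop :=
  crec (fun p => f (fst p) (snd p)).

Lemma enc_list_nat (w : list nat) : enc w = code w.
Proof. induction w as [| a w IH]; [reflexivity | simpl; now rewrite <- IH]. Qed.

Lemma crec_id A (cA : Coded A) : crec (fun x : A => x).
Proof. exists (fun x => x); split; [apply recf_id | reflexivity]. Qed.

Lemma crec_comp A B C (cA : Coded A) (cB : Coded B) (cC : Coded C) (g : B -> C) (f : A -> B) :
  crec g -> crec f -> crec (fun x => g (f x)).
Proof.
  intros [g' [Hg Eg]] [f' [Hf Ef]]; exists (fun x => g' (f' x)).
  split; [exact (recf_comp Hg Hf) | intros a; now rewrite Ef, Eg].
Qed.

Lemma crec_const A B (cA : Coded A) (cB : Coded B) (b : B) : crec (fun _ : A => b).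
Proof. exists (fun _ => enc b); split; [apply recf_const | reflexivity]. Qed.

Lemma crec_pair A B C (cA : Coded A) (cB : Coded B) (cC : Coded C) (f : A -> B) (g : A -> C) :
  crec f -> crec g -> crec (fun x => (f x, g x)).
Proof.
  intros [f' [Hf Ef]] [g' [Hg Eg]]; exists (fun x => npair (f' x) (g' x)).
  split; [exact (recf_npair Hf Hg) | intros a; now rewrite Ef, Eg].
Qed.

Lemma crec_comp2 A B C D (cA : Coded A) (cB : Coded B) (cC : Coded C) (cD : Coded D)
    (h : B -> C -> D) (f : A -> B) (g : A -> C) :
  crec2 h -> crec f -> crec g -> crec (fun x => h (f x) (g x)).
Proof. intros Hh Hf Hg; exact (crec_comp Hh (crec_pair Hf Hg)). Qed.

Lemma crec_fst A B C (cA : Coded A) (cB : Coded B) (cC : Coded C) (f : A -> B * C) :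
  crec f -> crec (fun x => fst (f x)).
Proof.
  intros [f' [Hf Ef]]; exists (fun x => nfst (f' x)).
  split; [exact (recf_comp recf_nfst Hf) |].
  intros a; rewrite Ef; unfold enc at 1, Coded_prod; now rewrite Cantor.cancel_of_to.
Qed.

Lemma crec_snd A B C (cA : Coded A) (cB : Coded B) (cC : Coded C) (f : A -> B * C) :
  crec f -> crec (fun x => snd (f x)).
Proof.
  intros [f' [Hf Ef]]; exists (fun x => nsnd (f' x)).
  split; [exact (recf_comp recf_nsnd Hf) |].
  intros a; rewrite Ef; unfold enc at 1, Coded_prod; now rewrite Cantor.cancel_of_to.
Qed.

Lemma crec_nat_rect A B (cA : Coded A) (cB : Coded B) (a : A -> B) (s : A -> nat -> B -> B)
    (n : A -> nat) :
  crec a -> crec (fun q => s (fst q) (fst (snd q)) (snd (snd q))) -> crec n ->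
  crec (fun x => nat_rect (fun _ => B) (a x) (s x) (n x)).
Proof.
  intros [a' [Ha Ea]] [s' [Hs Es]] [n' [Hn En]].
  exists (fun x => nat_rect (fun _ => nat) (a' x) (fun i r => s' (npair x (npair i r))) (n' x)).
  split; [exact (recf_prec Ha Hs Hn) |].
  intros x; rewrite Ea, En; change (enc (n x)) with (n x).
  induction (n x) as [| i IH]; [reflexivity | cbn [nat_rect]; rewrite IH].
  exact (Es (x, (i, _))).
Qed.

(** A primitive recursion whose step ignores the previous value: if [o x = S k], the last round has
    index [k] and alone decides the result. *)
Lemma recf_case (o a s : nat -> nat) :
  recf o -> recf a -> recf s ->
  recf (fun x => match o x with 0 => a x | S k => s (npair x k) end).
Proof.
  intros Ho Ha Hs.
  refine (recursive_ext (recf_prec (n := o) (s := fun y => s (npair (nfst y) (nfst (nsnd y))))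
    Ha _ Ho) _).
  - apply (recf_comp Hs), recf_npair; [apply recf_nfst |].
    exact (recf_comp recf_nfst recf_nsnd).
  - intros v; destruct (o (arg0 v)); [reflexivity |].
    cbn beta iota delta [nat_rec nat_rect].
    now rewrite !Cantor.cancel_of_to; cbn [fst snd]; rewrite !Cantor.cancel_of_to.
Qed.

Lemma crec_nat_case A B (cA : Coded A) (cB : Coded B) (n : A -> nat) (a : A -> B)
    (s : A -> nat -> B) :
  crec n -> crec a -> crec2 s -> crec (fun x => match n x with 0 => a x | S k => s x k end).
Proof.
  intros [n' [Hn En]] [a' [Ha Ea]] [s' [Hs Es]].
  exists (fun x => match n' x with 0 => a' x | S k => s' (npair x k) end).
  split; [exact (recf_case Hn Ha Hs) |].
  intros x; rewrite En, Ea; unfold enc at 1, Coded_nat.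
  destruct (n x) as [| k]; [reflexivity | exact (Es (x, k))].
Qed.

Lemma crec_if A B (cA : Coded A) (cB : Coded B) (b : A -> bool) (f g : A -> B) :
  crec b -> crec f -> crec g -> crec (fun x => if b x then f x else g x).
Proof.
  intros [b' [Hb Eb]] [f' [Hf Ef]] [g' [Hg Eg]].
  exists (fun x => match b' x with 0 => g' x | S k => f' (nfst (npair x k)) end).
  split; [exact (recf_case Hb Hg (recf_comp Hf recf_nfst)) |].
  intros x; rewrite Eb; destruct (b x); cbn; [rewrite Cantor.cancel_of_to |]; cbn; auto.
Qed.

Lemma crec_option_case A B C (cA : Coded A) (cB : Coded B) (cC : Coded C)
    (o : A -> option B) (s : A -> B -> C) (a : A -> C) :
  crec o -> crec2 s -> crec a ->
  crec (fun x => match o x with Some y => s x y | None => a x end).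
Proof.
  intros [o' [Ho Eo]] [s' [Hs Es]] [a' [Ha Ea]].
  exists (fun x => match o' x with 0 => a' x | S k => s' (npair x k) end).
  split; [exact (recf_case Ho Ha Hs) |].
  intros x; rewrite Eo; unfold enc at 1, Coded_option.
  destruct (o x) as [y |]; [exact (Es (x, y)) | apply Ea].
Qed.

Lemma crec_list_case A B C (cA : Coded A) (cB : Coded B) (cC : Coded C)
    (l : A -> list B) (a : A -> C) (s : A -> B -> list B -> C) :
  crec l -> crec a -> crec (fun q => s (fst q) (fst (snd q)) (snd (snd q))) ->
  crec (fun x => match l x with [] => a x | y :: t => s x y t end).
Proof.
  intros [l' [Hl El]] [a' [Ha Ea]] [s' [Hs Es]].
  exists (fun x => match l' x with 0 => a' x | S k => s' (npair x k) end).
  split; [exact (recf_case Hl Ha Hs) |].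
  intros x; rewrite El; destruct (l x) as [| y t]; [apply Ea | exact (Es (x, (y, t)))].
Qed.

Lemma crec_S A (cA : Coded A) (f : A -> nat) : crec f -> crec (fun x => S (f x)).
Proof.
  intros [f' [Hf Ef]]; exists (fun x => S (f' x)).
  split; [exact (recf_comp recf_S Hf) | intros x; now rewrite Ef].
Qed.

Lemma crec_Some A B (cA : Coded A) (cB : Coded B) (f : A -> B) :
  crec f -> crec (fun x => Some (f x)).
Proof.
  intros [f' [Hf Ef]]; exists (fun x => S (f' x)).
  split; [exact (recf_comp recf_S Hf) | intros x; now rewrite Ef].
Qed.

Lemma crec_cons A B (cA : Coded A) (cB : Coded B) (f : A -> B) (g : A -> list B) :
  crec f -> crec g -> crec (fun x => f x :: g x).
Proof.
  intros [f' [Hf Ef]] [g' [Hg Eg]]; exists (fun x => S (npair (f' x) (g' x))).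
  split; [exact (recf_comp recf_S (recf_npair Hf Hg)) | intros x; now rewrite Ef, Eg].
Qed.

Lemma crec_npair A (cA : Coded A) (f : A -> nat * nat) :
  crec f -> crec (fun x => Cantor.to_nat (f x)).
Proof.
  intros [f' [Hf Ef]]; exists f'; split; [exact Hf |].
  intros x; rewrite Ef; now destruct (f x).
Qed.

Lemma crec_of_nat A (cA : Coded A) (f : A -> nat) :
  crec f -> crec (fun x => Cantor.of_nat (f x)).
Proof.
  intros [f' [Hf Ef]]; exists f'; split; [exact Hf |].
  intros x; rewrite Ef; rewrite <- (Cantor.cancel_to_of (f x)) at 1.
  now destruct (Cantor.of_nat (f x)).
Qed.

Lemma crec_code A (cA : Coded A) (f : A -> list nat) : crec f -> crec (fun x => code (f x)).
Proof.
  intros [f' [Hf Ef]]; exists f'; split; [exact Hf |].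
  intros x; rewrite Ef; apply enc_list_nat.
Qed.

Lemma crec_ext A B (cA : Coded A) (cB : Coded B) (f g : A -> B) :
  crec f -> (forall x, f x = g x) -> crec g.
Proof. intros Hf E; now rewrite <- (functional_extensionality _ _ E). Qed.

Ltac crec_step :=
  match goal with
  | H : crec ?f |- crec (fun x => ?f (@?a x)) => refine (crec_comp H _)
  | H : crec2 ?f |- crec (fun x => ?f (@?a x) (@?b x)) => refine (crec_comp2 H _ _)
  | |- crec2 _ => unfold crec2
  | |- crec (fun x => x) => exact (@crec_id _ _)
  | |- crec (fun _ => ?b) => exact (@crec_const _ _ _ _ _)
  | |- crec (fun x => fst (@?a x)) => refine (crec_fst _)
  | |- crec (fun x => snd (@?a x)) => refine (crec_snd _)
  | |- crec (fun x => (@?a x, @?b x)) => refine (crec_pair _ _)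
  | |- crec (fun x => S (@?a x)) => refine (crec_S _)
  | |- crec (fun x => Some (@?a x)) => refine (crec_Some _)
  | |- crec (fun x => @?a x :: @?b x) => refine (crec_cons _ _)
  | |- crec (fun x => Cantor.to_nat (@?a x)) => refine (crec_npair _)
  | |- crec (fun x => Cantor.of_nat (@?a x)) => refine (crec_of_nat _)
  | |- crec (fun x => code (@?a x)) => refine (crec_code _)
  | |- crec (fun x => nat_rect _ (@?a x) (@?s x) (@?n x)) =>
      refine (@crec_nat_rect _ _ _ _ a s n _ _ _)
  | |- crec (fun x => match @?n x with 0 => @?a x | S k => @?s x k end) =>
      refine (@crec_nat_case _ _ _ _ n a s _ _ _)
  | |- crec (fun x => if @?b x then @?f x else @?g x) => refine (@crec_if _ _ _ _ b f g _ _ _)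
  | |- crec (fun x => match @?o x with Some y => @?s x y | None => @?a x end) =>
      refine (@crec_option_case _ _ _ _ _ _ o s a _ _ _)
  | |- crec (fun x => match @?l x with [] => @?a x | y :: t => @?s x y t end) =>
      refine (@crec_list_case _ _ _ _ _ _ l a s _ _ _)
  end; cbv beta.

Ltac crec_eta :=
  match goal with |- @crec ?A ?B ?cA ?cB ?f =>
    lazymatch f with
    | (fun _ => _) => fail
    | _ => refine (@crec_ext A B cA cB (fun x => f x) f _ (fun _ => eq_refl))
    end
  end.

(** A placeholder, redefined as soon as the closure lemmas for lists are available. *)
Ltac crec_list := fail.

Create HintDb crec.
Ltac crec := repeat first
  [ progress crec_step
  | progress crec_list
  | crec_eta
  | solve [auto 1 with crec nocore]
  | refine (crec_comp _ _); [solve [auto 1 with crec nocore] |]; cbv beta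
  | refine (crec_comp2 _ _ _); [solve [auto 1 with crec nocore] | |]; cbv beta ].

Lemma crec_pred : crec pred.
Proof.
  apply crec_ext with (f := fun n => match n with 0 => 0 | S k => k end); [crec |].
  now intros [| n].
Qed.
#[local] Hint Resolve crec_pred : crec.

Lemma crec2_add : crec2 Nat.add.
Proof.
  apply crec_ext with (f := fun p => nat_rect (fun _ => nat) (snd p) (fun _ r => S r) (fst p)).
  - crec.
  - intros [n m]; simpl; induction n; simpl; auto.
Qed.
#[local] Hint Resolve crec2_add : crec.

Lemma crec2_sub : crec2 Nat.sub.
Proof.
  apply crec_ext with (f := fun p => nat_rect (fun _ => nat) (fst p) (fun _ r => pred r) (snd p)).
  - crec.
  - intros [n m]; simpl; induction m; simpl; lia.
Qed.
#[local] Hint Resolve crec2_sub : crec.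

Lemma crec2_leb : crec2 Nat.leb.
Proof.
  apply crec_ext with (f := fun p => match fst p - snd p with 0 => true | S _ => false end).
  - crec.
  - intros [n m]; simpl; destruct (n - m) eqn:E; symmetry;
      [apply Nat.leb_le | apply Nat.leb_gt]; lia.
Qed.
#[local] Hint Resolve crec2_leb : crec.

Lemma crec2_eqb : crec2 Nat.eqb.
Proof.
  apply crec_ext with (f := fun p =>
    match (fst p - snd p) + (snd p - fst p) with 0 => true | S _ => false end).
  - crec.
  - intros [n m]; simpl; destruct (n - m + (m - n)) eqn:E; symmetry;
      [apply Nat.eqb_eq | apply Nat.eqb_neq]; lia.
Qed.
#[local] Hint Resolve crec2_eqb : crec.

Lemma crec_even : crec Nat.even.
Proof.
  apply crec_ext with (f := fun n =>
    nat_rect (fun _ => bool) true (fun _ b => if b then false else true) n).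
  - crec.
  - intros n; induction n as [| n IH]; [reflexivity |].
    rewrite Nat.even_succ, <- Nat.negb_even, <- IH; reflexivity.
Qed.
#[local] Hint Resolve crec_even : crec.

Lemma crec_div2 : crec Nat.div2.
Proof.
  apply crec_ext with (f := fun n =>
    nat_rect (fun _ => nat) 0 (fun i r => if Nat.even i then r else S r) n).
  - crec.
  - intros n; induction n as [| n IH]; [reflexivity |].
    cbn [nat_rect]; rewrite IH; destruct (Nat.Even_Odd_dec n) as [E | E].
    + rewrite (proj2 (Nat.even_spec n) E); now apply Nat.Even_div2.
    + rewrite <- Nat.negb_odd, (proj2 (Nat.odd_spec n) E); now apply Nat.Odd_div2.
Qed.
#[local] Hint Resolve crec_div2 : crec.

(** Lets the code of a list serve as the number of rounds of a recursion over it, at a point where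
    [length] is not yet known to be recursive. *)
Lemma enc_list_length A (cA : Coded A) (l : list A) : length l <= enc l.
Proof.
  induction l as [| a l IH]; [apply le_n |].
  pose proof (Cantor.to_nat_non_decreasing (enc a) (enc l)).
  change (S (length l) <= S (npair (enc a) (enc l))); lia.
Qed.

(** The recursion carries the accumulator and the unread rest of the list; surplus rounds find an
    empty rest and change nothing. *)
Lemma crec_fold_left A B C (cA : Coded A) (cB : Coded B) (cC : Coded C)
    (l : A -> list B) (s : A -> C -> B -> C) (a : A -> C) :
  crec l -> crec (fun q => s (fst q) (fst (snd q)) (snd (snd q))) -> crec a ->
  crec (fun x => fold_left (s x) (l x) (a x)).
Proof.
  intros Hl Hs Ha.
  set (step := fun (x : A) (_ : nat) (q : C * list B) =>
    match snd q with [] => q | y :: t => (s x (fst q) y, t) end).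
  apply crec_ext with
    (f := fun x => fst (nat_rect (fun _ => (C * list B)%type) (a x, l x) (step x) (enc (l x)))).
  - refine (crec_fst (@crec_nat_rect _ _ _ _ (fun x => (a x, l x)) step
      (fun x => enc (l x)) _ _ _));
      unfold step.
    + crec.
    + refine (@crec_list_case _ _ _ _ _ _ (fun q => snd (snd (snd q))) (fun q => snd (snd q))
        (fun q y t => (s (fst q) (fst (snd (snd q))) y, t)) _ _ _); [crec | crec |].
      apply crec_pair; [| crec].
      apply (crec_comp (f := fun q : A * (nat * (C * list B)) * (B * list B) =>
        (fst (fst q), (fst (snd (snd (fst q))), fst (snd q)))) Hs); crec.
    + destruct Hl as [l' [Hl El]]; exists l'; auto.
  - intros x.
    enough (H : forall n l a, length l <= n ->
      nat_rect (fun _ => (C * list B)%type) (a, l) (step x) n = (fold_left (s x) l a, [])).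
    { rewrite H; [reflexivity | apply enc_list_length]. }
    clear; intros n l a H.
    (* [nat_rect] adds rounds on the outside, whereas [fold_left] starts on the inside; as [step]
       ignores its index, a round can be moved to the front. *)
    enough (E : forall n k, nat_rect (fun _ => (C * list B)%type) k (step x) (S n) =
      nat_rect (fun _ => (C * list B)%type) (step x 0 k) (step x) n).
    { revert l a H; induction n as [| n IH]; intros [| y l] a H; simpl in H; try lia;
        [reflexivity | |]; rewrite E; unfold step at 1; simpl; apply IH; simpl; lia. }
    clear; intros n k; induction n as [| n IH]; [reflexivity |].
    cbn [nat_rect] in *; now rewrite IH.
Qed.

Lemma crec_rev A B (cA : Coded A) (cB : Coded B) (l : A -> list B) :
  crec l -> crec (fun x => rev (l x)).
Proof.
  intros Hl; apply crec_ext with (f := fun x => fold_left (fun t y => y :: t) (l x) []).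
  - refine (@crec_fold_left _ _ _ _ _ _ l (fun _ t y => y :: t) (fun _ => []) _ _ _); crec.
  - intros x; enough (H : forall t, fold_left (fun t y => y :: t) (l x) t = rev (l x) ++ t)
      by (rewrite H; apply app_nil_r).
    induction (l x) as [| y l' IH]; intros t; [reflexivity |].
    simpl; now rewrite IH, <- app_assoc.
Qed.

Ltac crec_list ::=
  match goal with
  | |- crec (fun x => fold_left (@?s x) (@?l x) (@?a x)) =>
      refine (@crec_fold_left _ _ _ _ _ _ l s a _ _ _)
  | |- crec (fun x => rev (@?l x)) => refine (crec_rev _)
  end; cbv beta.

Lemma crec_map A B C (cA : Coded A) (cB : Coded B) (cC : Coded C)
    (l : A -> list B) (f : A -> B -> C) :
  crec l -> crec2 f -> crec (fun x => map (f x) (l x)).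
Proof.
  intros Hl Hf.
  apply crec_ext with (f := fun x => rev (fold_left (fun t y => f x y :: t) (l x) [])).
  - crec.
  - intros x; enough (H : forall t, fold_left (fun t y => f x y :: t) (l x) t =
      rev (map (f x) (l x)) ++ t) by (now rewrite H, app_nil_r, rev_involutive).
    induction (l x) as [| y l' IH]; intros t; [reflexivity |].
    simpl; now rewrite IH, <- app_assoc.
Qed.

Lemma crec_app A B (cA : Coded A) (cB : Coded B) (u v : A -> list B) :
  crec u -> crec v -> crec (fun x => u x ++ v x).
Proof.
  intros Hu Hv.
  apply crec_ext with (f := fun x => fold_left (fun t y => y :: t) (rev (u x)) (v x)); [crec |].
  intros x; rewrite <- fold_left_rev_right, rev_involutive.
  induction (u x) as [| y l IH]; simpl; [| rewrite IH]; reflexivity.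
Qed.

Lemma crec_length A B (cA : Coded A) (cB : Coded B) (l : A -> list B) :
  crec l -> crec (fun x => length (l x)).
Proof.
  intros Hl; apply crec_ext with (f := fun x => fold_left (fun n _ => S n) (l x) 0); [crec |].
  intros x; enough (H : forall n, fold_left (fun n _ => S n) (l x) n = length (l x) + n)
    by (rewrite H; lia).
  induction (l x) as [| y t IH]; intros n; simpl; [| rewrite IH]; lia.
Qed.

Lemma crec_seq0 A (cA : Coded A) (n : A -> nat) : crec n -> crec (fun x => seq 0 (n x)).
Proof.
  intros Hn.
  apply crec_ext with (f := fun x =>
    rev (nat_rect (fun _ => list nat) [] (fun i r => i :: r) (n x)));
    [crec |].
  intros x; induction (n x) as [| i IH]; [reflexivity |].
  rewrite seq_S; simpl; now rewrite IH.
Qed.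

Lemma crec_nth_error A B (cA : Coded A) (cB : Coded B) (l : A -> list B) (n : A -> nat) :
  crec l -> crec n -> crec (fun x => nth_error (l x) (n x)).
Proof.
  intros Hl Hn.
  apply crec_ext with (f := fun x =>
    match nat_rect (fun _ => list B) (l x)
      (fun _ t => match t with [] => [] | _ :: t' => t' end) (n x)
    with [] => None | y :: _ => Some y end); [crec |].
  intros x; enough (E : nat_rect (fun _ => list B) (l x)
      (fun _ t => match t with [] => [] | _ :: t' => t' end) (n x) = skipn (n x) (l x)).
  { rewrite E; clear E; generalize (l x), (n x); intros t k; revert t;
      induction k as [| k IH]; intros [| y t]; simpl; auto. }
  induction (n x) as [| k IH]; [reflexivity |].
  cbn [nat_rect]; rewrite IH; clear; revert k; induction (l x) as [| y t IH]; intros [| k];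
    try reflexivity; apply IH.
Qed.

Lemma crec_firstn A B (cA : Coded A) (cB : Coded B) (n : A -> nat) (l : A -> list B) :
  crec n -> crec l -> crec (fun x => firstn (n x) (l x)).
Proof.
  intros Hn Hl.
  apply crec_ext with (f := fun x =>
    nat_rect (fun _ => list B) [] (fun i r =>
      match nth_error (l x) i with None => r | Some y => r ++ [y] end) (n x)).
  - refine (@crec_nat_rect _ _ _ _ (fun _ => []) (fun x i r =>
      match nth_error (l x) i with None => r | Some y => r ++ [y] end) n _ _ Hn); [crec |].
    refine (@crec_option_case _ _ _ _ _ _ (fun q => nth_error (l (fst q)) (fst (snd q)))
      (fun q y => snd (snd q) ++ [y]) (fun q => snd (snd q)) _ _ _).
    + apply crec_nth_error; crec.
    + apply crec_app; crec.
    + crec.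
  - intros x; induction (n x) as [| i IH]; [reflexivity |].
    cbn [nat_rect]; rewrite IH; clear; revert i.
    induction (l x) as [| y t IH]; intros [| i]; try reflexivity.
    change (firstn (S (S i)) (y :: t)) with (y :: firstn (S i) t).
    rewrite <- IH; simpl; now destruct (nth_error t i).
Qed.

(* The first argument is fuel. *)
Fixpoint decode_aux (d n : nat) : list nat :=
  match d with
  | 0 => []
  | S d' => match n with 0 => [] | S k => nfst k :: decode_aux d' (nsnd k) end
  end.

Definition decode (n : nat) : list nat := decode_aux n n.

(** The fuel [n] suffices because removing a letter lowers the code. As every number codes a word, a
    name can list a whole graph by letting a number run through all words. *)
Lemma code_decode n : code (decode n) = n.
Proof.
  unfold decode; enough (H : forall d k, k <= d -> code (decode_aux d k) = k) by (apply H; lia).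
  intros d; induction d as [| d IH]; intros [| k] Hk; try lia; try reflexivity.
  pose proof (Cantor.cancel_to_of k) as E; simpl; destruct (Cantor.of_nat k) as [x y].
  pose proof (Cantor.to_nat_non_decreasing x y).
  simpl; rewrite IH by lia; now rewrite E.
Qed.

Lemma code_inj u v : code u = code v -> u = v.
Proof.
  revert v; induction u as [| a u IH]; intros [| b v] E; try discriminate; [reflexivity |].
  injection E as E; apply Cantor.to_nat_inj in E; injection E as -> E.
  now rewrite (IH v E).
Qed.

Lemma decode_code w : decode (code w) = w.
Proof. apply code_inj, code_decode. Qed.

(** On the level of codes [decode] is the identity. *)
Lemma crec_decode A (cA : Coded A) (f : A -> nat) : crec f -> crec (fun x => decode (f x)).
Proof.
  intros [f' [Hf Ef]]; exists f'; split; [exact Hf |].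
  intros x; rewrite Ef, enc_list_nat, code_decode; reflexivity.
Qed.

Lemma crec_nth A (cA : Coded A) (l : A -> list nat) (n : A -> nat) :
  crec l -> crec n -> crec (fun x => nth (n x) (l x) 0).
Proof.
  intros Hl Hn; apply crec_ext with
    (f := fun x => match nth_error (l x) (n x) with Some y => y | None => 0 end).
  - refine (@crec_option_case _ _ _ _ _ _ (fun x => nth_error (l x) (n x)) (fun _ y => y)
      (fun _ => 0) _ _ _); [| crec | crec]; now apply crec_nth_error.
  - intros x; exact (nth_default_eq _ _ _).
Qed.

Lemma computable_word_fun_crec (phi : list nat -> list nat) :
  computable_word_fun phi <-> crec phi.
Proof.
  split.
  - intros [f [Hf E]]; exists (fun n => f (Vector.cons nat n 0 (Vector.nil nat))); split.
    + apply recursive_ext with (1 := Hf); intros v.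
      rewrite (Vector.eta v); unfold arg0; simpl.
      now rewrite (Vector.case0 (fun t => t = Vector.nil nat) eq_refl (Vector.tl v)).
    + intros w; now rewrite !enc_list_nat.
  - intros [f [Hf E]]; exists (fun v => f (arg0 v)); split; [exact Hf |].
    intros w; specialize (E w); now rewrite !enc_list_nat in E.
Qed.

Ltac crec_list ::=
  match goal with
  | |- crec (fun x => fold_left (@?s x) (@?l x) (@?a x)) =>
      refine (@crec_fold_left _ _ _ _ _ _ l s a _ _ _)
  | |- crec (fun x => map (@?f x) (@?l x)) => refine (@crec_map _ _ _ _ _ _ l f _ _)
  | |- crec (fun x => rev (@?l x)) => refine (crec_rev _)
  | |- crec (fun x => @?u x ++ @?v x) => refine (crec_app _ _)
  | |- crec (fun x => length (@?u x)) => refine (crec_length _)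
  | |- crec (fun x => seq 0 (@?u x)) => refine (crec_seq0 _)
  | |- crec (fun x => nth_error (@?u x) (@?v x)) => refine (crec_nth_error _ _)
  | |- crec (fun x => nth (@?v x) (@?u x) 0) => refine (crec_nth _ _)
  | |- crec (fun x => firstn (@?v x) (@?u x)) => refine (crec_firstn _ _)
  | |- crec (fun x => decode (@?v x)) => refine (crec_decode _)
  end; cbv beta.

(** * Approximation of computable functions by words *)

Definition pre (p : baire) (s : nat) : list nat := map p (seq 0 s).

Lemma pre_length p s : length (pre p s) = s.
Proof. unfold pre; now rewrite length_map, length_seq. Qed.

Lemma pre_S p s : pre p (S s) = pre p s ++ [p s].
Proof. unfold pre; now rewrite seq_S, map_app. Qed.

Lemma initial_pre p s : initial (pre p s) p.
Proof. unfold initial; now rewrite pre_length. Qed.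

Lemma nth_error_pre p s n : n < s -> nth_error (pre p s) n = Some (p n).
Proof.
  intros H; unfold pre; rewrite nth_error_map, nth_error_seq.
  now rewrite (proj2 (Nat.ltb_lt n s) H).
Qed.

Lemma nth_error_pre_inv p s n a : nth_error (pre p s) n = Some a -> n < s /\ a = p n.
Proof.
  intros E; assert (H : n < s).
  { rewrite <- (pre_length p s); apply nth_error_Some; now rewrite E. }
  rewrite (nth_error_pre p H) in E; split; congruence.
Qed.

Lemma nth_pre p s n d : n < s -> nth n (pre p s) d = p n.
Proof. intros H; apply nth_error_nth, nth_error_pre, H. Qed.

Lemma firstn_pre p s t : firstn s (pre p t) = pre p (min s t).
Proof.
  destruct (Nat.le_ge_cases s t) as [H | H].
  - rewrite Nat.min_l by exact H; replace t with (s + (t - s)) by lia.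
    unfold pre; rewrite seq_app, map_app, firstn_app, firstn_all2, length_map, length_seq,
      Nat.sub_diag by (rewrite length_map, length_seq; lia).
    apply app_nil_r.
  - rewrite Nat.min_r by exact H; apply firstn_all2; now rewrite pre_length.
Qed.

Lemma prefix_pre p s t : s <= t -> prefix (pre p s) (pre p t).
Proof.
  intros H; exists (skipn s (pre p t)).
  rewrite <- (firstn_skipn s (pre p t)) at 1; f_equal; rewrite firstn_pre; f_equal; lia.
Qed.

Lemma prefix_length u v : prefix u v -> length u <= length v.
Proof. intros [t ->]; rewrite length_app; lia. Qed.

Lemma initial_nth_error u p n a : initial u p -> nth_error u n = Some a -> a = p n.
Proof. intros -> E; exact (proj2 (nth_error_pre_inv E)). Qed.

Lemma sup_along_pre phi p r :
  monotone phi -> sup_along phi p r <->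
  (forall s, initial (phi (pre p s)) r) /\
  (forall n, exists s0, forall s, s0 <= s -> n < length (phi (pre p s))).
Proof.
  intros Hm; split; intros [H1 H2]; split.
  - intros s; apply H1, initial_pre.
  - intros n; destruct (H2 (S n)) as [w [Hw Hn]]; exists (length w); intros s Hs.
    red in Hw; fold (pre p (length w)) in Hw; rewrite Hw in Hn.
    pose proof (prefix_length (Hm _ _ (prefix_pre p Hs))); lia.
  - intros w ->; apply H1.
  - intros n; destruct (H2 n) as [s H]; exists (pre p s); split; [apply initial_pre |].
    apply Nat.lt_le_incl, H, le_n.
Qed.

Lemma sup_along_unique phi p r r' : sup_along phi p r -> sup_along phi p r' -> r = r'.
Proof.
  intros [H1 H2] [H1' _]; extensionality n; destruct (H2 (S n)) as [w [Hw Hn]].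
  destruct (nth_error (phi w) n) as [a |] eqn:E.
  - now rewrite <- (initial_nth_error (H1 w Hw) E), <- (initial_nth_error (H1' w Hw) E).
  - apply nth_error_None in E; lia.
Qed.

Lemma computable_single_valued F : computable F -> single_valued F.
Proof. intros [phi [_ [_ H]]] p r r' Hr Hr'; eapply sup_along_unique; eauto. Qed.

Lemma computable_sub (F F' : baire -> baire -> Prop) :
  computable F' -> (forall p r, F p r -> F' p r) -> computable F.
Proof. intros [phi [Hc [Hm H]]] Hsub; exists phi; eauto. Qed.

(* The digit [h w n] need not be monotone in [w]: only what it says on the initial segments of
   the inputs in the domain matters. *)
Definition approx (h : list nat -> nat -> option nat) (p r : baire) : Prop :=
  forall n, (forall s a, h (pre p s) n = Some a -> a = r n) /\
    exists s0, forall s, s0 <= s -> h (pre p s) n <> None.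

(** Stage [s] reads only the first [s] letters and asks for the next missing digit. Digits are
    appended and never revised, which makes [word_fun] monotone whatever [h] is. *)
Definition grow (h : list nat -> nat -> option nat) (w u : list nat) (s : nat) : list nat :=
  match h (firstn s w) (length u) with Some a => u ++ [a] | None => u end.

Definition word_fun (h : list nat -> nat -> option nat) (w : list nat) : list nat :=
  fold_left (grow h w) (seq 0 (S (length w))) [].

Lemma crec_word_fun h : crec2 h -> crec (word_fun h).
Proof. intros Hh; unfold word_fun, grow; crec. Qed.

Lemma word_fun_monotone h : monotone (word_fun h).
Proof.
  intros w w' [t ->]; unfold word_fun; rewrite length_app.
  rewrite <- Nat.add_succ_l, seq_app, fold_left_app.
  assert (E : forall l u, (forall s, In s l -> s <= length w) ->
    fold_left (grow h (w ++ t)) l u = fold_left (grow h w) l u).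
  { induction l as [| s l IH]; intros u Hl; [reflexivity |]; simpl.
    rewrite IH by (intros; apply Hl; now right); f_equal; unfold grow.
    rewrite firstn_app, (proj2 (Nat.sub_0_le _ _)) by (apply Hl; now left).
    now rewrite firstn_O, app_nil_r. }
  rewrite (E (seq 0 (S (length w)))) by (intros s Hs; apply in_seq in Hs; lia).
  generalize (fold_left (grow h w) (seq 0 (S (length w))) []).
  induction (seq (0 + S (length w)) (length t)) as [| s l IH]; intros u.
  - exists []; now rewrite app_nil_r.
  - simpl; destruct (IH (grow h (w ++ t) u s)) as [v Hv]; rewrite Hv; unfold grow.
    destruct (h _ _); [rewrite <- app_assoc |]; eexists; reflexivity.
Qed.

Lemma word_fun_pre_S h p s :
  word_fun h (pre p (S s)) =
  match h (pre p (S s)) (length (word_fun h (pre p s))) with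
  | Some a => word_fun h (pre p s) ++ [a]
  | None => word_fun h (pre p s)
  end.
Proof.
  unfold word_fun at 1; rewrite pre_length, seq_S, fold_left_app.
  assert (E : fold_left (grow h (pre p (S s))) (seq 0 (S s)) [] = word_fun h (pre p s)).
  { unfold word_fun; rewrite pre_length.
    enough (H : forall l u, (forall t, In t l -> t <= s) ->
      fold_left (grow h (pre p (S s))) l u = fold_left (grow h (pre p s)) l u)
      by (apply H; intros t Ht; apply in_seq in Ht; lia).
    induction l as [| t l IH]; intros u Hl; [reflexivity |]; simpl.
    rewrite IH by (intros; apply Hl; now right); f_equal; unfold grow.
    assert (t <= s) by (apply Hl; now left).
    now rewrite !firstn_pre, !Nat.min_l by lia. }
  rewrite E; cbn [fold_left]; unfold grow; rewrite Nat.add_0_l.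
  now rewrite firstn_pre, Nat.min_id.
Qed.

Lemma word_fun_sup_along h p r : approx h p r -> sup_along (word_fun h) p r.
Proof.
  intros H.
  assert (Hi : forall s, initial (word_fun h (pre p s)) r).
  { assert (Hstep : forall u s, initial u r -> initial
      (match h (pre p s) (length u) with Some a => u ++ [a] | None => u end) r).
    { intros u s Hu; destruct (h (pre p s) (length u)) as [a |] eqn:E; [| exact Hu].
      rewrite (proj1 (H _) _ _ E); red in Hu; fold (pre r (length u)) in Hu.
      rewrite Hu at 1; rewrite <- pre_S; apply initial_pre. }
    intros s; induction s as [| s IH].
    - apply (Hstep [] 0); reflexivity.
    - rewrite word_fun_pre_S; now apply Hstep. }
  apply sup_along_pre; [apply word_fun_monotone | split; [exact Hi |]].
  assert (Hl : forall s t, s <= t ->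
    length (word_fun h (pre p s)) <= length (word_fun h (pre p t))).
  { intros s t Hst; apply prefix_length, word_fun_monotone, prefix_pre, Hst. }
  (* If digit [n] is still missing at stage [max s s0], the next stage asks for it, and beyond [s0]
     the test is sure to answer. *)
  assert (Hgrow : forall n s, n <= length (word_fun h (pre p s)) ->
    exists s0, forall t, s0 <= t -> n < length (word_fun h (pre p t))).
  { intros n s Hs; destruct (proj2 (H n)) as [s0 Hs0]; exists (S (max s s0)); intros t Ht.
    apply Nat.lt_le_trans with (2 := Hl _ _ Ht).
    rewrite word_fun_pre_S; pose proof (Hl s (max s s0) (Nat.le_max_l _ _)).
    destruct (Nat.eq_dec n (length (word_fun h (pre p (max s s0))))) as [<- |].
    - destruct (h _ n) as [a |] eqn:E; [rewrite length_app; simpl; lia |].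
      exfalso; revert E; apply Hs0; lia.
    - destruct (h _ _); [rewrite length_app; simpl |]; lia. }
  intros n; induction n as [| n [s0 IH]]; [exact (Hgrow 0 0 (Nat.le_0_l _)) |].
  apply (Hgrow (S n) s0), IH, le_n.
Qed.

Lemma computable_approx (F : baire -> baire -> Prop) h :
  crec2 h -> (forall p r, F p r -> approx h p r) -> computable F.
Proof.
  intros Hh H; exists (word_fun h); split; [| split; [apply word_fun_monotone |]].
  - apply computable_word_fun_crec, crec_word_fun, Hh.
  - intros p r Hr; apply word_fun_sup_along, H, Hr.
Qed.

Lemma computable_elim (F : baire -> baire -> Prop) :
  computable F -> exists phi, crec phi /\ forall p r, F p r ->
    (forall s, initial (phi (pre p s)) r) /\
    (forall n, exists s0, forall s, s0 <= s -> n < length (phi (pre p s))).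
Proof.
  intros [phi [Hc [Hm H]]]; exists phi; split; [now apply computable_word_fun_crec |].
  intros p r Hr; apply (sup_along_pre _ _ Hm), H, Hr.
Qed.

(** * Closure properties *)

Lemma computable_elim_approx (F : baire -> baire -> Prop) :
  computable F -> exists phi, crec phi /\
    forall p r, F p r -> approx (fun w n => nth_error (phi w) n) p r.
Proof.
  intros HF; destruct (computable_elim HF) as [phi [Hc H]]; exists phi; split; [exact Hc |].
  intros p r Hr n; destruct (H p r Hr) as [H1 H2]; split.
  - intros s a E; exact (initial_nth_error (H1 s) E).
  - destruct (H2 n) as [s0 Hs0]; exists s0; intros s Hs; now apply nth_error_Some, Hs0.
Qed.

(** Numbers are passed to programs as constant sequences, which a single digit at a fixed position
    reveals. *)
Definition const (n : nat) : baire := fun _ => n.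
Definition fstB (x : baire) : baire := fun n => x (n + n).
Definition sndB (x : baire) : baire := fun n => x (S (n + n)).

Lemma even_double n : Nat.even (n + n) = true.
Proof. apply Nat.even_spec; exists n; lia. Qed.

Lemma even_S_double n : Nat.even (S (n + n)) = false.
Proof. now rewrite Nat.even_succ, <- Nat.negb_even, even_double. Qed.

Lemma div2_S_double n : Nat.div2 (S (n + n)) = n.
Proof. replace (n + n) with (2 * n) by lia; apply Nat.div2_succ_double. Qed.

Lemma div2_double n : Nat.div2 (n + n) = n.
Proof. replace (n + n) with (2 * n) by lia; apply Nat.div2_double. Qed.

Lemma even_or_odd n : (exists k, n = k + k) \/ (exists k, n = S (k + k)).
Proof.
  destruct (Nat.Even_Odd_dec n) as [[k ->] | [k ->]]; [left | right]; exists k; lia.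
Qed.

Lemma pair_even p q n : pair p q (n + n) = p n.
Proof. unfold pair; now rewrite even_double, div2_double. Qed.

Lemma pair_odd p q n : pair p q (S (n + n)) = q n.
Proof. unfold pair; now rewrite even_S_double, div2_S_double. Qed.

Lemma fstB_pair p q : fstB (pair p q) = p.
Proof. extensionality n; apply pair_even. Qed.

Lemma sndB_pair p q : sndB (pair p q) = q.
Proof. extensionality n; apply pair_odd. Qed.

Lemma pair_eta x : pair (fstB x) (sndB x) = x.
Proof.
  extensionality n; destruct (even_or_odd n) as [[k ->] | [k ->]];
    [rewrite pair_even | rewrite pair_odd]; reflexivity.
Qed.

Lemma pair_inj p q p' q' : pair p q = pair p' q' -> p = p' /\ q = q'.
Proof.
  intros E; split; [apply (f_equal fstB) in E | apply (f_equal sndB) in E];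
    now rewrite ?fstB_pair, ?sndB_pair in E.
Qed.

Lemma tuple_npair ps i j : tuple ps (npair i j) = ps i j.
Proof. unfold tuple; now rewrite Cantor.cancel_of_to. Qed.

(* Only meant for words of equal length. *)
Definition interleave (u v : list nat) : list nat :=
  map (fun n => nth (Nat.div2 n) (if Nat.even n then u else v) 0) (seq 0 (length u + length v)).

Lemma interleave_pre p q s : interleave (pre p s) (pre q s) = pre (pair p q) (s + s).
Proof.
  unfold interleave; rewrite !pre_length; apply map_ext_in; intros n Hn; apply in_seq in Hn.
  destruct (even_or_odd n) as [[k ->] | [k ->]].
  - now rewrite even_double, div2_double, pair_even, nth_pre by lia.
  - now rewrite even_S_double, div2_S_double, pair_odd, nth_pre by lia.
Qed.

Lemma crec2_interleave : crec2 interleave.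
Proof. unfold crec2, interleave; crec. Qed.
#[local] Hint Resolve crec2_interleave : crec.

(** Relational composition without the domain condition of [comp]; that condition is automatic here,
    since a computable [R] is single-valued. *)
Lemma computable_comp (R Q : baire -> baire -> Prop) :
  computable R -> computable Q -> computable (fun x z => exists y, R x y /\ Q y z).
Proof.
  intros [phi [Hc [Hm H]]] [psi [Hc' [Hm' H']]].
  exists (fun w => psi (phi w)); split; [| split].
  - apply computable_word_fun_crec in Hc, Hc'; apply computable_word_fun_crec; crec.
  - intros u v Huv; apply Hm', Hm, Huv.
  - intros x z [y [Hy Hz]]; specialize (H _ _ Hy); specialize (H' _ _ Hz).
    apply (sup_along_pre _ _ Hm) in H as [H1 H2]; destruct H' as [H1' H2']; split.
    + intros w ->; apply H1', H1.
    + intros n; destruct (H2' n) as [v [Hv Hn]]; destruct (H2 (length v)) as [s Hs].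
      exists (pre x s); split; [apply initial_pre |].
      apply Nat.le_trans with (1 := Hn), prefix_length, Hm'.
      specialize (Hs s (le_n _)); pose proof (H1 s) as E; red in Hv, E.
      rewrite Hv, E; apply (@prefix_pre y); lia.
Qed.

Lemma computable_pair (R Q : baire -> baire -> Prop) :
  computable R -> computable Q ->
  computable (fun x z => exists y y', R x y /\ Q x y' /\ z = pair y y').
Proof.
  intros HR HQ; destruct (computable_elim_approx HR) as [phi [Hc H]].
  destruct (computable_elim_approx HQ) as [psi [Hc' H']].
  apply computable_approx with
    (h := fun w n => nth_error (if Nat.even n then phi w else psi w) (Nat.div2 n)).
  - unfold crec2; crec.
  - intros p r [y [y' [Hy [Hy' ->]]]] n; unfold pair; destruct (Nat.even n);
      [exact (H p y Hy _) | exact (H' p y' Hy' _)].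
Qed.

(** The branch not taken may be undefined; this is what permits calling [U] under a condition. *)
Lemma computable_case (T R Q : baire -> baire -> Prop) :
  computable T -> computable R -> computable Q ->
  computable (fun x z => exists t, T x t /\ ((t 0 = 0 /\ R x z) \/ (t 0 <> 0 /\ Q x z))).
Proof.
  intros HT HR HQ; destruct (computable_elim_approx HR) as [phi [Hc H]].
  destruct (computable_elim_approx HQ) as [psi [Hc' H']].
  destruct (computable_elim_approx HT) as [tau [Hc'' H'']].
  apply computable_approx with (h := fun w n =>
    match nth_error (tau w) 0 with
    | Some a => match a with 0 => nth_error (phi w) n | S _ => nth_error (psi w) n end
    | None => None
    end).
  - unfold crec2.
    refine (@crec_option_case _ _ _ _ _ _ (fun q => nth_error (tau (fst q)) 0)
      (fun q a => match a with 0 => nth_error (phi (fst q)) (snd q)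
         | S _ => nth_error (psi (fst q)) (snd q) end) (fun _ => None) _ _ _); crec.
  - intros x z [t [Ht D]] n; destruct (H'' _ _ Ht 0) as [E [s0 Hs0]].
    destruct D as [[Z D] | [Z D]]; [destruct (H _ _ D n) as [E' [s1 Hs1]] |
      destruct (H' _ _ D n) as [E' [s1 Hs1]]]; (split; [| exists (max s0 s1)]; intros s).
    + intros a; specialize (E s); destruct (nth_error (tau (pre x s)) 0) as [b |]; [| easy].
      rewrite (E b eq_refl), Z; apply E'.
    + intros Hs; specialize (E s); specialize (Hs0 s); specialize (Hs1 s).
      destruct (nth_error (tau (pre x s)) 0) as [b |]; [| exfalso; apply Hs0; [lia | reflexivity]].
      rewrite (E b eq_refl), Z; apply Hs1; lia.
    + intros a; specialize (E s); destruct (nth_error (tau (pre x s)) 0) as [b |]; [| easy].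
      specialize (E b eq_refl); destruct b; [congruence | apply E'].
    + intros Hs; specialize (E s); specialize (Hs0 s); specialize (Hs1 s).
      destruct (nth_error (tau (pre x s)) 0) as [b |]; [| exfalso; apply Hs0; [lia | reflexivity]].
      specialize (E b eq_refl); destruct b; [congruence | apply Hs1; lia].
Qed.

Lemma map_const_pre i s : map (fun _ => i) (seq 0 s) = pre (const i) s.
Proof. reflexivity. Qed.

(** One procedure serves all components because it receives the index as an additional input. *)
Lemma computable_tuple (R : baire -> baire -> Prop) :
  computable R ->
  computable (fun x z => exists ys, (forall i, R (pair (const i) x) (ys i)) /\ z = tuple ys).
Proof.
  intros HR; destruct (computable_elim_approx HR) as [phi [Hc H]].
  apply computable_approx with (h := fun w n =>
    nth_error (phi (interleave (map (fun _ => nfst n) (seq 0 (length w))) w)) (nsnd n)).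
  - unfold crec2; crec.
  - intros x z [ys [Hys ->]] n; unfold tuple; rewrite <- (Cantor.cancel_to_of n).
    destruct (Cantor.of_nat n) as [i j]; rewrite Cantor.cancel_of_to; cbn [fst snd].
    destruct (H _ _ (Hys i) j) as [E [s0 Hs0]]; split; [| exists s0]; intros s;
      rewrite pre_length, map_const_pre, interleave_pre; [apply E |].
    intros Hs; apply Hs0; lia.
Qed.

Definition find_first A (test : nat -> option A) (l : list nat) : option A :=
  fold_left (fun acc i => match acc with Some y => Some y | None => test i end) l None.

Lemma find_first_snoc A (test : nat -> option A) l i :
  find_first test (l ++ [i]) =
  match find_first test l with Some y => Some y | None => test i end.
Proof. unfold find_first; now rewrite fold_left_app. Qed.

Lemma find_first_Some A (test : nat -> option A) n y :
  find_first test (seq 0 n) = Some y ->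
  exists i, i < n /\ test i = Some y /\ forall j, j < i -> test j = None.
Proof.
  assert (HN : forall m, find_first test (seq 0 m) = None -> forall j, j < m -> test j = None).
  { induction m as [| m IH]; [lia |]; rewrite seq_S, find_first_snoc; intros E j Hj.
    destruct (find_first test (seq 0 m)) eqn:E'; [easy |].
    destruct (Nat.eq_dec j m) as [-> |]; [exact E | apply IH; [reflexivity | lia]]. }
  induction n as [| n IH]; [easy |]; rewrite seq_S, find_first_snoc; intros E.
  destruct (find_first test (seq 0 n)) as [y' |] eqn:E'.
  - destruct (IH E) as [i [Hi H]]; exists i; split; [lia | exact H].
  - exists n; split; [lia | split; [exact E | exact (HN n E')]].
Qed.

Lemma find_first_not_None A (test : nat -> option A) n i :
  i < n -> test i <> None -> find_first test (seq 0 n) <> None.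
Proof.
  intros Hi Ht; induction n as [| n IH]; [lia |]; rewrite seq_S, find_first_snoc.
  destruct (Nat.eq_dec i n) as [-> |].
  - destruct (find_first test (seq 0 n)); easy.
  - destruct (find_first test (seq 0 n)); [easy | exfalso; apply IH; [lia | reflexivity]].
Qed.

Lemma crec_find_first A B (cA : Coded A) (cB : Coded B) (test : A -> nat -> option B)
    (l : A -> list nat) :
  crec2 test -> crec l -> crec (fun x => find_first (test x) (l x)).
Proof.
  intros Ht Hl; unfold find_first.
  refine (@crec_fold_left _ _ _ _ _ _ l (fun x acc i =>
    match acc with Some y => Some y | None => test x i end) (fun _ => None) Hl _ _); [| crec].
  refine (@crec_option_case _ _ _ _ _ _ (fun q => fst (snd q)) (fun _ y => Some y)
    (fun q => test (fst q) (snd (snd q))) _ _ _); crec.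
Qed.

(** Unbounded search: a prefix is scanned from 0 without gaps, so the bounded search either fails or
    already returns the least zero. *)
Lemma computable_search :
  computable (fun x z => exists t, x t = 0 /\ (forall s, s < t -> x s <> 0) /\ z = const t).
Proof.
  apply computable_approx with (h := fun w _ => find_first (fun i =>
    match nth_error w i with
    | Some a => match a with 0 => Some i | S _ => None end
    | None => None
    end) (seq 0 (length w))).
  - unfold crec2.
    refine (@crec_find_first _ _ _ _ (fun q i => match nth_error (fst q) i with
      | Some a => match a with 0 => Some i | S _ => None end
      | None => None end) _ _ _); [unfold crec2 | crec].
    refine (@crec_option_case _ _ _ _ _ _ (fun q => nth_error (fst (fst q)) (snd q))
      (fun q a => match a with 0 => Some (snd q) | S _ => None end) (fun _ => None) _ _ _); crec.
  - intros x z [t [Ht [Hmin ->]]] n; split.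
    + intros s a E; apply find_first_Some in E as [i [Hi [E Hj]]]; rewrite pre_length in Hi.
      rewrite nth_error_pre in E by exact Hi; destruct (x i) eqn:Ei; [injection E as <- | easy].
      unfold const; destruct (Nat.lt_trichotomy i t) as [L | [L | L]];
        [exfalso; exact (Hmin i L Ei) | exact L |].
      specialize (Hj t L); rewrite nth_error_pre, Ht in Hj by lia; easy.
    + exists (S t); intros s Hs; rewrite pre_length; apply find_first_not_None with t; [lia |].
      now rewrite nth_error_pre, Ht by lia.
Qed.

Definition ctot (f : baire -> baire) : Prop := computable (fun x y => y = f x).

Lemma computable_ctot (R : baire -> baire -> Prop) f :
  computable R -> ctot f -> computable (fun x z => R (f x) z).
Proof.
  intros HR Hf; apply (computable_sub (computable_comp Hf HR)); intros x z H; now exists (f x).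
Qed.

Lemma ctot_comp f g : ctot g -> ctot f -> ctot (fun x => g (f x)).
Proof. apply computable_ctot. Qed.

Lemma ctot_pair f g : ctot f -> ctot g -> ctot (fun x => pair (f x) (g x)).
Proof.
  intros Hf Hg; apply (computable_sub (computable_pair Hf Hg)).
  intros x z ->; now exists (f x), (g x).
Qed.

Lemma ctot_case t f g :
  ctot t -> ctot f -> ctot g -> ctot (fun x => match t x 0 with 0 => f x | S _ => g x end).
Proof.
  intros Ht Hf Hg; apply (computable_sub (computable_case Ht Hf Hg)); intros x z ->.
  exists (t x); split; [reflexivity |]; destruct (t x 0); [left | right]; auto.
Qed.

Lemma ctot_tuple f : ctot f -> ctot (fun x => tuple (fun i => f (pair (const i) x))).
Proof.
  intros Hf; apply (computable_sub (computable_tuple Hf)); intros x z ->.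
  now exists (fun i => f (pair (const i) x)).
Qed.

(** Covers projections, array accesses and counters alike. An output digit depends on one input
    digit, whose position is computed from the output position and from digits 0 and 1, where up to
    two numeric parameters are kept. *)
Lemma ctot_look (m : nat -> nat -> nat -> nat) (G : nat -> nat -> nat -> nat -> nat) f :
  crec (fun q => m (fst q) (fst (snd q)) (snd (snd q))) ->
  crec (fun q => G (fst q) (fst (snd q)) (fst (snd (snd q))) (snd (snd (snd q)))) ->
  (forall y n, f y n = G (y (m (y 0) (y 1) n)) (y 0) (y 1) n) ->
  ctot f.
Proof.
  intros Hm HG Hf; apply computable_approx with (h := fun w n =>
    match nth_error w (m (nth 0 w 0) (nth 1 w 0) n) with
    (* For shorter words the default value of [nth] could be taken for a parameter. *)
    | Some c => if 2 <=? length w then Some (G c (nth 0 w 0) (nth 1 w 0) n) else None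
    | None => None
    end).
  - unfold crec2.
    refine (@crec_option_case _ _ _ _ _ _
      (fun q => nth_error (fst q) (m (nth 0 (fst q) 0) (nth 1 (fst q) 0) (snd q)))
      (fun q c => if 2 <=? length (fst q)
        then Some (G c (nth 0 (fst q) 0) (nth 1 (fst q) 0) (snd q)) else None)
      (fun _ => None) _ _ _); [| | crec].
    + apply crec_nth_error; [crec |].
      refine (crec_comp (f := fun q : list nat * nat =>
        (nth 0 (fst q) 0, (nth 1 (fst q) 0, snd q))) Hm _); crec.
    + unfold crec2; apply crec_if; [crec | | crec]; apply crec_Some.
      refine (crec_comp (f := fun q : list nat * nat * nat =>
        (snd q, (nth 0 (fst (fst q)) 0, (nth 1 (fst (fst q)) 0, snd (fst q))))) HG _); crec.
  - intros y r -> n; split.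
    + intros s a; rewrite pre_length; destruct (Nat.leb_spec 2 s) as [Hs | Hs];
        [| destruct (nth_error _ _); easy].
      rewrite !nth_pre by lia.
      destruct (nth_error _ _) as [c |] eqn:E; [| easy].
      apply nth_error_pre_inv in E as [_ ->]; intros E; injection E as <-; now rewrite Hf.
    + exists (S (S (m (y 0) (y 1) n))); intros s Hs.
      rewrite !nth_pre, nth_error_pre, pre_length by lia.
      now destruct (Nat.leb_spec 2 s); [| lia].
Qed.

(** * The universal function and the recursion theorem *)

Definition odds (w : list nat) : list nat :=
  map (fun j => nth (S (j + j)) w 0) (seq 0 (Nat.div2 (length w))).

Lemma div2_bounds s : Nat.div2 s + Nat.div2 s <= s <= S (Nat.div2 s + Nat.div2 s).
Proof.
  destruct (even_or_odd s) as [[k ->] | [k ->]]; rewrite ?div2_double, ?div2_S_double; lia.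
Qed.

Lemma odds_pre q p s : odds (pre (pair q p) s) = pre p (Nat.div2 s).
Proof.
  unfold odds; rewrite pre_length; apply map_ext_in; intros j Hj; apply in_seq in Hj.
  pose proof (div2_bounds s); rewrite nth_pre by lia; apply pair_odd.
Qed.

Lemma crec_odds : crec odds.
Proof. unfold odds; crec. Qed.
#[local] Hint Resolve crec_odds : crec.

(** The contribution of a single digit [k] of a name to output position [n]. The comparison of codes
    also fails while [w] is shorter than the listed input word, so a digit is used only after that
    word has been confirmed. *)
Definition use_digit (w : list nat) (n k : nat) : option nat :=
  if 3 <=? k then
    if code (firstn (length (decode (nfst (k - 3)))) w) =? nfst (k - 3)
    then nth_error (decode (nsnd (k - 3))) n else None
  else None.

Lemma crec_use_digit : crec (fun q => use_digit (fst q) (fst (snd q)) (snd (snd q))).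
Proof. unfold use_digit; crec. Qed.

Lemma use_digit_Some p s n k a :
  use_digit (pre p s) n k = Some a ->
  exists u v, k = 3 + npair (code u) (code v) /\ initial u p /\ nth_error v n = Some a.
Proof.
  unfold use_digit; destruct (Nat.leb_spec 3 k) as [Hk |]; [| easy].
  destruct (Nat.eqb_spec (code (firstn (length (decode (nfst (k - 3)))) (pre p s))) (nfst (k - 3)))
    as [E |]; [| easy].
  intros Ha; exists (decode (nfst (k - 3))), (decode (nsnd (k - 3))); rewrite !code_decode.
  rewrite <- surjective_pairing, Cantor.cancel_to_of; split; [lia | split; [| exact Ha]].
  rewrite <- E at 1; rewrite decode_code, firstn_pre; apply initial_pre.
Qed.

Lemma use_digit_lists p s n u v :
  initial u p -> length u <= s -> n < length v ->
  use_digit (pre p s) n (3 + npair (code u) (code v)) <> None.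
Proof.
  intros Hu Hs Hn; unfold use_digit; simpl Nat.leb; cbv iota.
  replace (3 + npair (code u) (code v) - 3) with (npair (code u) (code v)) by lia.
  rewrite Cantor.cancel_of_to; cbn [fst snd]; rewrite !decode_code, firstn_pre.
  rewrite Nat.min_l by exact Hs.
  red in Hu; fold (pre p (length u)) in Hu; rewrite <- Hu, Nat.eqb_refl.
  now apply nth_error_Some.
Qed.

(** Which digit of the name is found first may change as more input is read. This is harmless: by
    the first clause of [Phi], all applicable digits agree with [r]. *)
Lemma computable_U : computable U.
Proof.
  apply computable_approx with (h := fun w n => find_first (fun i =>
    match nth_error w (i + i) with Some k => use_digit (odds w) n k | None => None end)
    (seq 0 (length w))).
  - unfold crec2.
    refine (@crec_find_first _ _ _ _ (fun q i => match nth_error (fst q) (i + i) with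
      | Some k => use_digit (odds (fst q)) (snd q) k | None => None end) _ _ _);
      [unfold crec2 | crec].
    refine (@crec_option_case _ _ _ _ _ _ (fun q => nth_error (fst (fst q)) (snd q + snd q))
      (fun q k => use_digit (odds (fst (fst q))) (snd (fst q)) k) (fun _ => None) _ _ _);
      [crec | | crec].
    unfold crec2; refine (crec_comp (f := fun q : list nat * nat * nat * nat =>
      (odds (fst (fst (fst q))), (snd (fst (fst q)), snd q))) crec_use_digit _); crec.
  - intros x r [q [p [-> [H1 H2]]]] n; split.
    + intros s a E; apply find_first_Some in E as [i [_ [E _]]].
      destruct (nth_error _ (i + i)) as [k |] eqn:Ek; [| easy].
      apply nth_error_pre_inv in Ek as [_ ->]; rewrite odds_pre in E; rewrite pair_even in E.
      apply use_digit_Some in E as [u [v [Ek [Hu Ha]]]].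
      exact (initial_nth_error (H1 u v (ex_intro _ i Ek) Hu) Ha).
    + destruct (H2 (S n)) as [u [v [[i Ei] [Hu Hn]]]].
      exists (S (i + i) + S (length u + length u)); intros s Hs; rewrite pre_length.
      apply find_first_not_None with i; [lia |].
      rewrite odds_pre, nth_error_pre, pair_even, Ei by lia.
      apply use_digit_lists; [exact Hu | | lia].
      pose proof (div2_bounds s); lia.
Qed.

(* The even digits list the graph of [phi] with its first argument fixed to [y]; the odd digits
   list pairs with an empty second word, which do not matter, and store [y]. *)
Definition smn (phi : list nat -> list nat) (y : baire) : baire := fun n =>
  if Nat.even n then
    3 + npair (Nat.div2 n) (code (phi (interleave (pre y (length (decode (Nat.div2 n))))
      (decode (Nat.div2 n)))))
  else 3 + npair (code [y (Nat.div2 n)]) (code []).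

(** Undoes the storage in the odd digits of [smn]; [code [a]] is the successor of the pair of [a]
    and 0, whence the [pred]. *)
Definition smn_data (z : baire) : baire := fun n => nfst (pred (nfst (z (S (n + n)) - 3))).

Lemma smn_data_smn phi y : smn_data (smn phi y) = y.
Proof.
  extensionality n; unfold smn_data, smn; rewrite even_S_double, div2_S_double.
  replace (3 + npair (code [y n]) (code []) - 3) with (npair (code [y n]) (code [])) by lia.
  rewrite Cantor.cancel_of_to; simpl; now rewrite Cantor.cancel_of_to.
Qed.

Lemma smn_0 phi y : smn phi y 0 <> 0.
Proof. discriminate. Qed.

Lemma ctot_smn_data : ctot smn_data.
Proof.
  apply ctot_look with (m := fun _ _ n => S (n + n))
    (G := fun c _ _ _ => nfst (pred (nfst (c - 3))));
    [crec | crec | reflexivity].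
Qed.

Lemma ctot_smn phi : crec phi -> ctot (smn phi).
Proof.
  intros Hphi; apply computable_approx with (h := fun w n =>
    if Nat.even n then
      if length (decode (Nat.div2 n)) <=? length w then
        Some (3 + npair (Nat.div2 n)
          (code (phi (interleave (firstn (length (decode (Nat.div2 n))) w) (decode (Nat.div2 n))))))
      else None
    else match nth_error w (Nat.div2 n) with
    | Some a => Some (3 + npair (code [a]) (code []))
    | None => None
    end).
  - unfold crec2; apply crec_if; [crec | crec |].
    refine (@crec_option_case _ _ _ _ _ _ (fun q => nth_error (fst q) (Nat.div2 (snd q)))
      (fun _ a => Some (3 + npair (code [a]) (code []))) (fun _ => None) _ _ _); crec.
  - intros y r -> n; unfold smn; destruct (Nat.even n); split.
    + intros s a; rewrite pre_length, firstn_pre.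
      destruct (Nat.leb_spec (length (decode (Nat.div2 n))) s) as [Hs |]; [| easy].
      rewrite Nat.min_l by exact Hs; congruence.
    + exists (length (decode (Nat.div2 n))); intros s Hs; rewrite pre_length.
      now rewrite (proj2 (Nat.leb_le _ _) Hs).
    + intros s a; destruct (nth_error _ _) as [b |] eqn:E; [| easy].
      apply nth_error_pre_inv in E as [_ ->]; congruence.
    + exists (S (Nat.div2 n)); intros s Hs; now rewrite nth_error_pre by lia.
Qed.

(** Only prefixes of [pair y p] of even length occur, as interleavings of equally long prefixes of
    [y] and [p]; they suffice because the outputs of [phi] are long on all sufficiently long
    prefixes. The odd digits list the empty output and impose nothing. *)
Lemma Phi_smn phi y p r :
  (forall s, initial (phi (pre (pair y p) s)) r) ->
  (forall n, exists s0, forall s, s0 <= s -> n < length (phi (pre (pair y p) s))) ->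
  Phi (smn phi y) p r.
Proof.
  intros H1 H2; split.
  - intros u v [n E] Hu; unfold smn in E; destruct (Nat.even n); apply Nat.add_cancel_l in E;
      apply Cantor.to_nat_inj in E; pose proof (f_equal fst E) as Eu;
      apply (f_equal snd) in E; cbn [fst snd] in Eu, E; apply code_inj in E; subst v;
      [| reflexivity].
    rewrite Eu, decode_code; red in Hu; fold (pre p (length u)) in Hu.
    rewrite Hu at 2; rewrite interleave_pre; apply H1.
  - intros n; destruct (H2 n) as [s Hs].
    exists (pre p s), (phi (pre (pair y p) (s + s))); split; [| split; [apply initial_pre |]].
    + exists (code (pre p s) + code (pre p s)); unfold smn.
      now rewrite even_double, div2_double, decode_code, pre_length, interleave_pre.
    + apply Nat.lt_le_incl, Hs; lia.
Qed.

Lemma computable_name R :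
  computable R -> exists g, ctot (fun _ => g) /\ forall p r, R p r -> Phi g p r.
Proof.
  intros HR; destruct (computable_elim HR) as [phi [Hc H]].
  exists (fun n => 3 + npair n (code (phi (decode n)))); split.
  - apply ctot_look with (m := fun _ _ n => n)
      (G := fun _ _ _ n => 3 + npair n (code (phi (decode n)))); [crec | crec | reflexivity].
  - intros p r Hr; destruct (H p r Hr) as [H1 H2]; split.
    + intros u v [n E] Hu; apply Nat.add_cancel_l, Cantor.to_nat_inj in E.
      injection E as -> E; apply code_inj in E; rewrite <- E, decode_code.
      red in Hu; fold (pre p (length u)) in Hu; rewrite Hu; apply H1.
    + intros n; destruct (H2 n) as [s Hs]; exists (pre p s), (phi (pre p s)).
      split; [| split; [apply initial_pre | now apply Nat.lt_le_incl, Hs]].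
      exists (code (pre p s)); now rewrite decode_code.
Qed.

Lemma ctot_fst : ctot fstB.
Proof.
  apply ctot_look with (m := fun _ _ n => n + n) (G := fun c _ _ _ => c);
    [crec | crec | reflexivity].
Qed.

Lemma ctot_snd : ctot sndB.
Proof.
  apply ctot_look with (m := fun _ _ n => S (n + n)) (G := fun c _ _ _ => c);
    [crec | crec | reflexivity].
Qed.

Lemma ctot_id : ctot (fun x => x).
Proof.
  apply ctot_look with (m := fun _ _ n => n) (G := fun c _ _ _ => c); [crec | crec | reflexivity].
Qed.

Lemma ctot_const n : ctot (fun _ => const n).
Proof.
  apply ctot_look with (m := fun _ _ n => n) (G := fun _ _ _ _ => n); [crec | crec | reflexivity].
Qed.

(* The name [S <g,x>] of the program runs [R] on its own parameters [g] and [x], so that [R] may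
   refer to the names [S <g,x'>] for other [x']. *)
Theorem recursion_theorem :
  exists S D : baire -> baire, ctot S /\ ctot D /\ (forall y, D (S y) = y) /\
    (forall y, S y 0 <> 0) /\
    forall R, computable R -> exists g, ctot (fun _ => g) /\
      forall x p r, R (pair (pair g x) p) r -> Phi (S (pair g x)) p r.
Proof.
  (* On [pair (pair g x) p] the program [g] is run on this whole input, so that it receives its own
     name [g] as data. *)
  assert (HE : computable (fun x z => U (pair (fstB (fstB x)) x) z)).
  { apply (computable_ctot computable_U), ctot_pair; [| apply ctot_id].
    apply (ctot_comp (g := fstB)); apply ctot_fst. }
  destruct (computable_elim HE) as [phi [Hc H]].
  exists (smn phi), smn_data; split; [now apply ctot_smn | split; [apply ctot_smn_data |]].
  split; [apply smn_data_smn | split; [apply smn_0 |]].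
  intros R HR; destruct (computable_name HR) as [g [Hg HgR]]; exists g; split; [exact Hg |].
  intros x p r Hr; destruct (H (pair (pair g x) p) r) as [H1 H2]; [| now apply Phi_smn].
  exists g, (pair (pair g x) p); rewrite !fstB_pair; split; [reflexivity | exact (HgR _ _ Hr)].
Qed.

(** * Reductions *)

Lemma comp_single_valued (X Y Z : Type) (g : Y -> Z -> Prop) (f : X -> Y -> Prop) :
  single_valued f -> single_valued g -> single_valued (comp g f).
Proof.
  intros Hf Hg x z z' [_ [y [Hy Hz]]] [_ [y' [Hy' Hz']]].
  rewrite (Hf _ _ _ Hy' Hy) in Hz'; exact (Hg _ _ _ Hz Hz').
Qed.

Lemma comp_intro (X Y Z : Type) (g : Y -> Z -> Prop) (f : X -> Y -> Prop) x y z :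
  single_valued f -> f x y -> g y z -> comp g f x z.
Proof.
  intros Hf Hy Hz; split; [| now exists y].
  intros y' Hy'; rewrite (Hf _ _ _ Hy' Hy); now exists z.
Qed.

(** Trades realizers for names: a realizer of [g] only promises some name [r] of some solution [y'],
    so [H] has to cope with all of them. *)
Lemma le_sW_intro (X Y Z V : rep_space) (f : mvf X Y) (g : mvf Z V) (H K : baire -> baire -> Prop) :
  computable H -> computable K ->
  (forall p x, delta p x -> dom f x ->
    exists p' x', K p p' /\ delta p' x' /\ dom g x' /\
      forall r y', delta r y' -> g x' y' -> exists z y, H r z /\ delta z y /\ f x y) ->
  le_sW f g.
Proof.
  intros HH HK Hred; exists H, K; split; [exact HH | split; [exact HK |]].
  apply computable_single_valued in HH, HK.
  intros G [Gs HG]; split; [auto using comp_single_valued |].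
  intros p x Hp Hx; destruct (Hred p x Hp Hx) as [p' [x' [Hp' [Hx' [Hdom Hout]]]]].
  destruct (HG p' x' Hx' Hdom) as [r [y' [Hr [Hy' Hg]]]].
  destruct (Hout r y' Hy' Hg) as [z [y [Hz Hy]]]; exists z, y; split; [| exact Hy].
  apply comp_intro with r; [auto using comp_single_valued | | exact Hz].
  now apply comp_intro with p'.
Qed.

Lemma le_sW_trans (X Y Z V S T : rep_space) (f : mvf X Y) (g : mvf Z V) (h : mvf S T) :
  le_sW f g -> le_sW g h -> le_sW f h.
Proof.
  intros [H1 [K1 [HH1 [HK1 R1]]]] [H2 [K2 [HH2 [HK2 R2]]]].
  exists (fun x z => exists y, H2 x y /\ H1 y z), (fun x z => exists y, K1 x y /\ K2 y z).
  pose proof (computable_comp HH2 HH1) as HH; pose proof (computable_comp HK1 HK2) as HK.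
  split; [exact HH | split; [exact HK |]]; intros G HG.
  destruct (R1 _ (R2 _ HG)) as [_ HR]; destruct HG as [Gs _].
  apply computable_single_valued in HH, HK; split; [auto using comp_single_valued |].
  intros p x Hp Hx; destruct (HR p x Hp Hx) as [z [y [Hz Hy]]]; exists z, y; split; [| exact Hy].
  destruct Hz as [_ [r [[_ [k1 [Hk1 [_ [s [[_ [k2 [Hk2 Hs]]] Hr]]]]]] Hz]]].
  apply comp_intro with s; [auto using comp_single_valued | | now exists r].
  apply comp_intro with k2; [exact HK | now exists k1 | exact Hs].
Qed.

Lemma id_times_pair (f : mvf Baire Baire) a b z :
  id_times f (pair a b) z <-> exists c, f b c /\ z = pair a c.
Proof.
  split.
  - intros [a' [b' [c [E [Hc ->]]]]]; apply pair_inj in E as [-> ->]; now exists c.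
  - intros [c [Hc ->]]; now exists a, b, c.
Qed.

Lemma U_pair q p r : U (pair q p) r <-> Phi q p r.
Proof.
  split; [| intros H; now exists q, p].
  intros [q' [p' [E H]]]; now apply pair_inj in E as [-> ->].
Qed.

Lemma U_single_valued : single_valued U.
Proof. apply computable_single_valued, computable_U. Qed.

Lemma id_times_single_valued (f : mvf Baire Baire) : single_valued f -> single_valued (id_times f).
Proof.
  intros Hf x z z' [a [b [c [-> [Hc ->]]]]] H; apply id_times_pair in H as [c' [Hc' ->]].
  now rewrite (Hf _ _ _ Hc' Hc).
Qed.

Lemma L_single_valued (f : mvf Baire Baire) : single_valued f -> single_valued (L f).
Proof. intros Hf; apply comp_single_valued; auto using id_times_single_valued, U_single_valued. Qed.

Lemma L_iff (f : mvf Baire Baire) x y :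
  single_valued f -> L f x y <-> exists z, id_times f x z /\ U z y.
Proof.
  intros Hf; split; [now intros [_ H] |].
  intros [z [Hz Hy]]; apply comp_intro with z; auto using id_times_single_valued.
Qed.

Lemma L_pair (f : mvf Baire Baire) a b c y :
  single_valued f -> f b c -> Phi a c y -> L f (pair a b) y.
Proof.
  intros Hf Hc Hy; apply L_iff; [exact Hf |]; exists (pair a c); split.
  - now apply id_times_pair; exists c.
  - now apply U_pair.
Qed.

(** Each stage of a deterministic run is a singleton, so one infinite run already witnesses the
    domain condition. *)
Lemma inf_loop_iff (f : mvf Baire Baire) p s :
  single_valued f ->
  inf_loop f p s <-> exists q, q 0 = p /\ (forall i, L f (q i) (q (S i))) /\ s = tuple q.
Proof.
  intros Hf; split; [now intros [_ H] |]; intros [q [Hq0 [Hq Es]]]; split; [| now exists q].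
  intros i x Hx; assert (E : x = q i); [| rewrite E; now exists (q (S i))].
  revert x Hx; induction i as [| i IH]; intros x; simpl; [congruence |].
  intros [y [Hy Hx]]; rewrite (IH y Hy) in Hx; exact (L_single_valued Hf Hx (Hq i)).
Qed.

Lemma iterate_SS (f : mvf Baire Baire) n p z :
  iterate f (S (S n)) p z -> exists y x, iterate f (S n) p y /\ U y x /\ id_times f x z.
Proof. intros [_ [x [[_ [y [Hy Hx]]] Hz]]]; now exists y, x. Qed.

Lemma iterate_single_valued (f : mvf Baire Baire) n :
  single_valued f -> single_valued (iterate f n).
Proof.
  intros Hf; induction n as [| [| n] IH]; [intros x y y'; unfold iterate, id_Baire; congruence | |].
  - now apply id_times_single_valued.
  - repeat apply comp_single_valued; auto using id_times_single_valued, U_single_valued.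
Qed.

(** Separates the states [q n] from the results [r (S n)] of the calls: [omega] records the latter,
    and the loop the former. *)
Lemma omega_iff (f : mvf Baire Baire) p s :
  single_valued f ->
  omega f p s <-> exists q r, q 0 = p /\ r 0 = p /\ s = tuple r /\
    forall n, id_times f (q n) (r (S n)) /\ U (r (S n)) (q (S n)).
Proof.
  intros Hf; split.
  - intros [r [Hr ->]].
    (* [U] is defined on component [S n] because component [S (S n)] exists. The chosen sequence
       starts with the second state, so [p] is put in front of it below. *)
    destruct (functional_choice (fun n x => U (r (S n)) x)) as [q Hq].
    { intros n; destruct (iterate_SS (Hr (S (S n)))) as [y [x [Hy [Hx _]]]]; exists x.
      now rewrite (iterate_single_valued Hf Hy (Hr (S n))) in Hx. }
    exists (fun n => match n with 0 => p | S n => q n end), r.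
    split; [reflexivity | split; [symmetry; exact (Hr 0) | split; [reflexivity |]]].
    intros n; split; [| apply Hq]; destruct n as [| n]; [exact (Hr 1) |].
    destruct (iterate_SS (Hr (S (S n)))) as [y [x [Hy [Hx Hz]]]].
    rewrite (iterate_single_valued Hf Hy (Hr (S n))) in Hx.
    now rewrite (U_single_valued Hx (Hq n)) in Hz.
  - intros [q [r [Hq0 [Hr0 [-> H]]]]]; exists r; split; [| reflexivity].
    intros [| n]; [now symmetry |]; induction n as [| n IH].
    + rewrite <- Hq0; apply H.
    + apply comp_intro with (q (S n)); [| | apply H].
      * apply comp_single_valued; [| apply U_single_valued].
        exact (iterate_single_valued (n := S n) Hf).
      * apply comp_intro with (r (S n)); [| exact IH | apply H].
        exact (iterate_single_valued (n := S n) Hf).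
Qed.

(** * The infinite loop below omega *)

Lemma inf_loop_omega (f : mvf Baire Baire) p :
  single_valued f -> dom (inf_loop f) p -> dom (omega f) p.
Proof.
  intros Hf [s Hs]; apply (inf_loop_iff _ _ Hf) in Hs as [q [Hq0 [Hq _]]].
  destruct (functional_choice (fun n z => id_times f (q n) z /\ U z (q (S n)))) as [r Hr].
  { intros n; exact (proj1 (L_iff _ _ Hf) (Hq n)). }
  exists (tuple (fun n => match n with 0 => p | S n => r n end)).
  apply (omega_iff _ _ Hf); exists q, (fun n => match n with 0 => p | S n => r n end).
  now repeat split; [| apply Hr..].
Qed.

Definition nthB (y : baire) : baire :=
  fun n => y (S (npair (y 0) n + npair (y 0) n)).

Lemma nthB_tuple i xs : nthB (pair (const i) (tuple xs)) = xs i.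
Proof. extensionality n; unfold nthB; rewrite pair_odd; apply tuple_npair. Qed.

Lemma ctot_nthB : ctot nthB.
Proof.
  apply ctot_look with (m := fun a _ n => S (npair a n + npair a n)) (G := fun c _ _ _ => c);
    [crec | crec | reflexivity].
Qed.

Ltac ctot := repeat match goal with
  | |- computable (fun x y => y = @?f x) => change (ctot f)
  | H : ctot (fun _ => ?g) |- ctot (fun _ => ?g) => exact H
  | H : ctot ?f |- ctot (fun x => ?f (@?a x)) => apply (ctot_comp H)
  | |- ctot (fun x => x) => exact ctot_id
  | |- ctot (fun _ => const ?n) => exact (ctot_const n)
  | |- ctot (fun x => fstB (@?a x)) => apply (ctot_comp ctot_fst)
  | |- ctot (fun x => sndB (@?a x)) => apply (ctot_comp ctot_snd)
  | |- ctot (fun x => nthB (@?a x)) => apply (ctot_comp ctot_nthB)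
  | |- ctot (fun x => pair (@?a x) (@?b x)) => apply ctot_pair
  | |- ctot (pair ?g) => apply (@ctot_pair (fun _ => g) (fun x => x))
  | |- ctot fstB => exact ctot_fst
  | |- ctot sndB => exact ctot_snd
  | |- ctot nthB => exact ctot_nthB
  end.

Lemma inf_loop_le_omega (f : mvf Baire Baire) :
  single_valued f -> le_sW (inf_loop f) (omega f).
Proof.
  intros Hf.
  (* The tested digit is the index itself: component 0, which is the starting point, passes
     unchanged, and [U] is applied to all others. *)
  pose proof (computable_tuple (computable_case ctot_id ctot_nthB
    (computable_ctot computable_U ctot_nthB))) as HH.
  apply le_sW_intro with (1 := HH) (2 := ctot_id); intros p x E Hx; change (p = x) in E; subst x.
  exists p, p; split; [reflexivity | split; [reflexivity |]].
  split; [now apply inf_loop_omega |]; intros s s' E Hs; change (s = s') in E; subst s'.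
  apply (omega_iff _ _ Hf) in Hs as [q [r [Hq0 [Hr0 [-> Hqr]]]]].
  exists (tuple q), (tuple q); split; [| split; [reflexivity |]].
  - exists q; split; [| reflexivity]; intros i; rewrite nthB_tuple; eexists; split; [reflexivity |].
    destruct i as [| i]; [left | right]; (split; [| try apply Hqr; congruence]); easy.
  - apply (inf_loop_iff _ _ Hf); exists q; split; [exact Hq0 | split; [| reflexivity]].
    intros i; apply (L_iff _ _ Hf); exists (r (S i)); apply Hqr.
Qed.

(** * Runs of the diamond, and omega below its parallelization *)

Lemma diamond_stop (f : mvf Baire Baire) (x : baire) : x 0 = 0 -> diamond f x x.
Proof.
  intros Hx; split.
  - split; [intros k q <- [_ [_ H]] | intros q <- [_ H]]; apply (H 0); auto with arith.
  - exists 0, (fun _ => x); split; [reflexivity | split; [| reflexivity]].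
    split; [intros i Hi; lia | split; [exact Hx | intros i Hi; lia]].
Qed.

(** The domain condition speaks about all runs; by single-valuedness, each run that leaves [x] goes
    to [x'], and its tail is a run from there. *)
Lemma diamond_step (f : mvf Baire Baire) (x x' y : baire) :
  single_valued f -> x 0 <> 0 -> L f x x' -> diamond f x' y -> diamond f x y.
Proof.
  intros Hf Hx Hx' [[Hst Hinf] [k [q [Hq0 [[Hrun [Hk Hnz]] ->]]]]].
  assert (Hq1 : forall s, s 0 = x -> L f (s 0) (s 1) -> s 1 = x').
  { intros s <- H; exact (L_single_valued Hf H Hx'). }
  split; [split |].
  - intros [| l] s Hs [Hr [Hd Hn]]; [apply Hd; rewrite Hs; now exists x' |].
    apply (Hst l (fun i => s (S i))); [apply Hq1, Hr; auto with arith |].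
    split; [intros i Hi; apply Hr; lia | split; [exact Hd | intros i Hi; apply Hn; lia]].
  - intros s Hs [Hr Hn]; apply (Hinf (fun i => s (S i))); [apply Hq1, Hr; exact Hs |].
    split; intros i; [apply Hr | apply Hn].
  - exists (S k), (fun i => match i with 0 => x | S j => q j end).
    split; [reflexivity | split; [| reflexivity]]; split; [| split; [exact Hk |]].
    + intros [| i] Hi; [now rewrite Hq0 | apply Hrun; lia].
    + intros [| i] Hi; [exact Hx | apply Hnz; lia].
Qed.

Lemma diamond_single_valued (f : mvf Baire Baire) : single_valued f -> single_valued (diamond f).
Proof.
  intros Hf x z z' [_ [k [q [Hq0 [[Hrun [Hk Hnz]] ->]]]]]
    [_ [k' [q' [Hq0' [[Hrun' [Hk' Hnz']] ->]]]]].
  assert (E : forall i, i <= k -> i <= k' -> q i = q' i).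
  { induction i as [| i IH]; intros Hi Hi'; [congruence |].
    apply (L_single_valued Hf (Hrun i Hi)); rewrite IH by lia; now apply Hrun'. }
  destruct (Nat.lt_trichotomy k k') as [Hlt | [<- | Hlt]].
  - exfalso; apply (Hnz' k Hlt); rewrite <- E; auto with arith.
  - now apply E.
  - exfalso; apply (Hnz k' Hlt); rewrite E; auto with arith.
Qed.

Lemma delta_seq_Baire (p : baire) (x : nat -> baire) :
  @delta (seq_space Baire) p x <-> p = tuple x.
Proof.
  split; [| intros ->; now exists x].
  intros [ps [-> H]]; f_equal; extensionality i; apply H.
Qed.

Definition counter (h : nat -> nat) (y : baire) : baire := const (h (y 0)).

Lemma ctot_counter h : crec h -> ctot (counter h).
Proof.
  intros Hh; apply ctot_look with (m := fun _ _ n => n) (G := fun _ a _ _ => h a);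
    [crec | crec | reflexivity].
Qed.

(* The diamond is run on the states [n, q]: with [n = 0] it stops and returns [q]; otherwise it
   makes one call of [f] for [q] and decrements [n]. *)
Lemma omega_le_diamond (f : mvf Baire Baire) :
  single_valued f -> le_sW (omega f) (parallelization (diamond f)).
Proof.
  intros Hf; destruct recursion_theorem as [P [_ [HP [_ [_ [HP0 Hrec]]]]]].
  (* The counter is a parameter of the program and is lowered in advance: with [n' = 0] the program
     returns the answer without applying [U], since [omega] records results before [U]. Names made
     by [P] do not begin with 0, so only the leading [const 0] stops the diamond. *)
  set (state := fun g n q => match n with
    | 0 => pair (const 0) q
    | S n' => pair (P (pair g (pair (const n') (fstB q)))) (sndB q)
    end).
  (* The same map on the single argument [pair (const n) (pair g q)], so that it can be shown
     computable. *)
  set (stateB := fun y : baire => match fstB y 0 with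
    | 0 => pair (const 0) (sndB (sndB y))
    | S _ => pair (P (pair (fstB (sndB y)) (pair (counter pred (fstB y)) (fstB (sndB (sndB y))))))
        (sndB (sndB (sndB y)))
    end).
  assert (HsB : forall g n q, stateB (pair (const n) (pair g q)) = state g n q).
  { intros g n q; unfold stateB; rewrite !sndB_pair, !fstB_pair; now destruct n. }
  pose proof (ctot_counter crec_pred) as Hpred.
  assert (Hs : ctot stateB) by (apply ctot_case; ctot).
  (* Here [w] is [pair (pair g (pair (const n') (fstB q))) c] with [c] the answer of [f]. The
     auxiliary [w'] and [v] match the shape of the closure lemmas; [v] carries [w] along with the
     next state found by [U]. *)
  set (R := fun w z => exists t, t = fstB (sndB (fstB w)) /\
    ((t 0 = 0 /\ z = pair (const 0) (pair (sndB (sndB (fstB w))) (sndB w))) \/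
     (t 0 <> 0 /\ exists v, (exists w' q, w' = w /\
        U (pair (sndB (sndB (fstB w))) (sndB w)) q /\ v = pair w' q) /\
      z = stateB (pair (fstB (sndB (fstB (fstB v)))) (pair (fstB (fstB (fstB v))) (sndB v)))))).
  assert (HR : computable R).
  { apply computable_case; [ctot | ctot |]; apply computable_comp; [| ctot].
    apply computable_pair; [exact ctot_id |]; apply (computable_ctot computable_U); ctot. }
  destruct (Hrec R HR) as [g [Hg HgR]].
  (* The start [i] is kept general because a step lowers the counter while moving one state
     ahead. *)
  assert (Hrun : forall q r, (forall n, id_times f (q n) (r (S n)) /\ U (r (S n)) (q (S n))) ->
    forall n i, diamond f (state g (S n) (q i)) (pair (const 0) (r (S (n + i))))).
  { intros q r H n; induction n as [| n IH]; intros i; destruct (H i) as [Hqr HU];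
      rewrite <- (pair_eta (q i)) in Hqr; apply id_times_pair in Hqr as [c [Hc Er]];
      (eapply diamond_step; [exact Hf | apply HP0 | eapply L_pair; [exact Hf | exact Hc |] |]).
    - apply HgR; eexists; split; [reflexivity |].
      rewrite !fstB_pair, !sndB_pair, fstB_pair; left; split; reflexivity.
    - rewrite <- Er; now apply diamond_stop.
    - apply HgR; eexists; split; [reflexivity |].
      rewrite !fstB_pair, !sndB_pair, fstB_pair; right; split; [easy |].
      exists (pair (pair (pair g (pair (const (S n)) (fstB (q i)))) c) (q (S i))); split.
      + do 2 eexists; split; [reflexivity | split; [| reflexivity]]; now rewrite <- Er.
      + rewrite !fstB_pair, !sndB_pair, !fstB_pair; symmetry; apply HsB.
    - rewrite <- Nat.add_succ_r; apply IH. }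
  apply le_sW_intro with (H := fun x z => z = tuple (fun i => sndB (nthB (pair (const i) x))))
    (K := fun x z => z = tuple (fun i => stateB (pair (fstB (pair (const i) x))
      (pair g (sndB (pair (const i) x)))))).
  { apply (ctot_tuple (f := fun y => sndB (nthB y))); ctot. }
  { apply (ctot_tuple (f := fun y => stateB (pair (fstB y) (pair g (sndB y))))); ctot. }
  intros p x E [s0 Hs0]; change (p = x) in E; subst x.
  apply (omega_iff _ _ Hf) in Hs0 as [q [r [Hq0 [Hr0 [-> Hqr]]]]].
  assert (Hd : forall i, diamond f (state g i p) (pair (const 0) (r i))).
  { intros [| i]; [rewrite Hr0; now apply diamond_stop |].
    rewrite <- Hq0; rewrite <- (Nat.add_0_r i) at 2; now apply Hrun. }
  exists (tuple (fun i => state g i p)), (fun i => state g i p); split; [| split; [| split]].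
  - f_equal; extensionality i; now rewrite fstB_pair, sndB_pair, HsB.
  - now apply delta_seq_Baire.
  - exists (fun i => pair (const 0) (r i)); exact Hd.
  - intros s y Hy Hdy; apply delta_seq_Baire in Hy; subst s.
    exists (tuple r), (tuple r); split; [| split; [reflexivity |]].
    + f_equal; extensionality i; rewrite nthB_tuple.
      now rewrite (diamond_single_valued Hf (Hdy i) (Hd i)), sndB_pair.
    + apply (omega_iff _ _ Hf); now exists q, r.
Qed.

(** * The parallelized diamond below the infinite loop *)

Lemma pointed_input (f : mvf Baire Baire) :
  single_valued f -> pointed f -> exists b c, ctot (fun _ => b) /\ f b c.
Proof.
  intros Hf [H [K [_ [HK HG]]]].
  (* A single-valued [f] realizes itself; at the computable point [const 0], the map [K] then has to
     produce an input in the domain of [f]. *)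
  destruct (HG f) as [_ HGr].
  { split; [exact Hf |]; intros p x E [y Hy]; change (p = x) in E; subst x.
    exists y, y; split; [exact Hy | split; [reflexivity | exact Hy]]. }
  destruct (HGr (const 0) (const 0)) as [z [_ [[_ [_ [[c [[_ [b [Hb Hc]]] _]] _]]] _]]];
    [reflexivity | now exists (const 0) |].
  exists b, c; split; [| exact Hc].
  apply (computable_sub (computable_comp (ctot_const 0) HK)); intros x y ->.
  now exists (const 0).
Qed.

(** In [pair (pair (const i) q) (tuple xs)] digit 0 is [i], [q] occupies the positions congruent to
    2 modulo 4, and the tuple the odd ones. *)
Definition update (y : baire) : baire := fun n =>
  if nfst n =? y 0 then y (S (nsnd n + nsnd n) + S (nsnd n + nsnd n)) else y (S (n + n)).

Lemma update_tuple i q xs :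
  update (pair (pair (const i) q) (tuple xs)) = tuple (fun j => if j =? i then q else xs j).
Proof.
  extensionality n; unfold update; rewrite pair_even, !pair_odd.
  change (pair (pair (const i) q) (tuple xs) 0) with i.
  unfold tuple; destruct (Cantor.of_nat n) as [j m]; cbn [fst snd]; now destruct (j =? i).
Qed.

Lemma ctot_update : ctot update.
Proof.
  apply ctot_look with
    (m := fun a _ n => if nfst n =? a then S (nsnd n + nsnd n) + S (nsnd n + nsnd n) else S (n + n))
    (G := fun c _ _ _ => c); [crec | crec |].
  intros y n; unfold update; now destruct (nfst n =? y 0).
Qed.

(** Pass [s] of the dovetailing serves instance [nfst s]; this counts the passes before [t] that
    serve [i]. *)
Definition steps (t i : nat) : nat :=
  nat_rect (fun _ => nat) 0 (fun s c => if i =? nfst s then S c else c) t.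

Lemma steps_unbounded i k : exists t, k <= steps t i.
Proof.
  induction k as [| k [t IH]]; [exists 0; auto with arith |].
  (* Pass [npair i t] serves [i] and does not come before pass [t]. *)
  exists (S (npair i t)); pose proof (Cantor.to_nat_non_decreasing i t).
  assert (Hm : forall s d, steps s i <= steps (d + s) i).
  { intros s d; induction d as [| d IHd]; [apply le_n |].
    simpl; destruct (i =? nfst (d + s)); unfold steps in *; lia. }
  specialize (Hm t (npair i t - t)); replace (npair i t - t + t) with (npair i t) in Hm by lia.
  simpl; fold (steps (npair i t) i); rewrite Cantor.cancel_of_to, Nat.eqb_refl; lia.
Qed.

(** Applied to an index [i] and the history of all states: the first digits of instance [i] over
    time, whose first zero marks the end of its run. *)
Definition column (y : baire) : baire := fun n =>
  y (S (npair n (npair (y 0) 0) + npair n (npair (y 0) 0))).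

Definition entry (y : baire) : baire := fun n =>
  y (S (S (npair (y 0) (npair (y 1) n) + npair (y 0) (npair (y 1) n))
     + S (npair (y 0) (npair (y 1) n) + npair (y 0) (npair (y 1) n)))).

Lemma column_tuple i (xs : nat -> nat -> baire) :
  column (pair (const i) (tuple (fun t => tuple (xs t)))) = fun t => xs t i 0.
Proof.
  extensionality t; unfold column; change (pair (const i) _ 0) with i.
  now rewrite pair_odd, !tuple_npair.
Qed.

Lemma entry_tuple t i (xs : nat -> nat -> baire) :
  entry (pair (const t) (pair (const i) (tuple (fun t => tuple (xs t))))) = xs t i.
Proof.
  extensionality n; unfold entry; change (pair (const t) _ 0) with t.
  change (pair (const t) _ 1) with i.
  now rewrite !pair_odd, !tuple_npair.
Qed.

Lemma ctot_column : ctot column.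
Proof.
  apply ctot_look with (m := fun a _ n => S (npair n (npair a 0) + npair n (npair a 0)))
    (G := fun c _ _ _ => c); [crec | crec | reflexivity].
Qed.

Lemma ctot_entry : ctot entry.
Proof.
  apply ctot_look with (m := fun a b n =>
      S (S (npair a (npair b n) + npair a (npair b n))
         + S (npair a (npair b n) + npair a (npair b n))))
    (G := fun c _ _ _ => c); [crec | crec | reflexivity].
Qed.

Lemma diamond_le_inf_loop (f : mvf Baire Baire) :
  single_valued f -> pointed f -> le_sW (parallelization (diamond f)) (inf_loop f).
Proof.
  intros Hf Hpt; destruct (pointed_input Hf Hpt) as [b0 [c0 [Hb0 Hfb0]]].
  destruct recursion_theorem as [P [D [HP [HD [HDP [_ Hrec]]]]]].
  assert (Hsucc : ctot (counter S)) by (apply ctot_counter; crec).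
  assert (Hidx : ctot (counter (fun t => nfst t))) by (apply ctot_counter; crec).
  pose proof ctot_update as Hupd; pose proof ctot_column as Hcol; pose proof ctot_entry as Hent.
  set (cur := fun v : baire => nthB (pair (counter (fun t => nfst t) (fstB v)) (sndB v))).
  assert (Hcur : ctot cur) by (unfold cur; ctot).
  (* The program stores the pass number and the states of all instances. The second half is the
     input of the next call; [b0] stands in for a stopped instance, whose state may hold no legal
     input. *)
  set (state := fun y : baire => pair
    (P (pair (fstB (sndB y)) (pair (fstB y) (sndB (sndB y)))))
    (match cur (pair (fstB y) (sndB (sndB y))) 0 with
     | 0 => b0
     | S _ => sndB (cur (pair (fstB y) (sndB (sndB y))))
     end)).
  assert (Hstate : ctot state).
  { apply ctot_pair; [ctot |].
    apply (@ctot_case (fun y => cur (pair (fstB y) (sndB (sndB y)))) (fun _ => b0)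
      (fun y => sndB (cur (pair (fstB y) (sndB (sndB y)))))); ctot. }
  (* For a stopped instance the answer is discarded and only the pass number advances; otherwise the
     instance's own program is applied to the answer and its state is replaced. *)
  set (R := fun w z => exists x, x = cur (sndB (fstB w)) /\
    ((x 0 = 0 /\ z = state (pair (counter S (fstB (sndB (fstB w))))
                             (pair (fstB (fstB w)) (sndB (sndB (fstB w)))))) \/
     (x 0 <> 0 /\ exists v,
       (exists w' q, w' = w /\ U (pair (fstB (cur (sndB (fstB w)))) (sndB w)) q /\ v = pair w' q) /\
       z = state (pair (counter S (fstB (sndB (fstB (fstB v)))))
             (pair (fstB (fstB (fstB v)))
               (update (pair
                  (pair (counter (fun t => nfst t) (fstB (sndB (fstB (fstB v))))) (sndB v))
                  (sndB (sndB (fstB (fstB v))))))))))).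
  assert (HR : computable R).
  { apply computable_case; [ctot | ctot |]; apply computable_comp; [| ctot].
    apply computable_pair; [exact ctot_id |]; apply (computable_ctot computable_U); ctot. }
  destruct (Hrec R HR) as [g [Hg HgR]].
  set (Q := fun t xs => state (pair (const t) (pair g (tuple xs)))).
  assert (HQ : forall t xs, Q t xs = pair (P (pair g (pair (const t) (tuple xs))))
    (match xs (nfst t) 0 with 0 => b0 | S _ => sndB (xs (nfst t)) end)).
  { intros t xs; unfold Q, state; rewrite !fstB_pair, !sndB_pair, fstB_pair; unfold cur.
    rewrite fstB_pair, sndB_pair; unfold counter, const at 1; now rewrite nthB_tuple. }
  assert (Hcurt : forall t xs, cur (pair (const t) (tuple xs)) = xs (nfst t)).
  { intros t xs; unfold cur; rewrite fstB_pair, sndB_pair; apply nthB_tuple. }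
  assert (Hstop : forall t xs, xs (nfst t) 0 = 0 -> L f (Q t xs) (Q (S t) xs)).
  { intros t xs Hx; rewrite HQ, Hx; apply (L_pair Hf Hfb0), HgR; eexists; split; [reflexivity |].
    rewrite !fstB_pair, !sndB_pair, fstB_pair, Hcurt; left; split; [exact Hx | reflexivity]. }
  assert (Hgo : forall t xs x, xs (nfst t) 0 <> 0 -> L f (xs (nfst t)) x ->
    L f (Q t xs) (Q (S t) (fun j => if j =? nfst t then x else xs j))).
  { intros t xs x Hx HL; apply (L_iff _ _ Hf) in HL as [c [Hc HU]].
    rewrite <- (pair_eta (xs (nfst t))) in Hc; apply id_times_pair in Hc as [c' [Hc ->]].
    rewrite HQ; destruct (xs (nfst t) 0) eqn:Ex; [easy |].
    apply (L_pair Hf Hc), HgR; eexists; split; [reflexivity |].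
    rewrite !fstB_pair, !sndB_pair, fstB_pair, Hcurt; right; split; [congruence |].
    exists (pair (pair (pair g (pair (const t) (tuple xs))) c') x); split.
    - now do 2 eexists; split; [reflexivity | split; [| reflexivity]].
    - rewrite !fstB_pair, !sndB_pair, !fstB_pair; unfold Q; rewrite <- update_tuple.
      reflexivity. }
  (* For each [i]: search the history for the first time at which instance [i] shows the digit 0,
     and return its state at that time. *)
  pose proof (computable_tuple (computable_ctot (computable_comp
    (computable_pair
      (computable_comp Hcol computable_search) ctot_id) Hent) ctot_id)) as HH.
  (* [D] recovers the parameters from the program of each loop state; the two [sndB] strip [g] and
     the pass number. *)
  assert (HX : ctot (fun z => tuple (fun t => sndB (sndB (D (fstB (nthB (pair (const t) z)))))))).
  { apply (ctot_tuple (f := fun y => sndB (sndB (D (fstB (nthB y)))))); ctot. }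
  apply le_sW_intro with (1 := computable_comp HX HH)
    (K := fun x z => z = state (pair (const 0) (pair g x))); [ctot |].
  intros p x Hp [y Hy]; apply delta_seq_Baire in Hp; subst p.
  destruct (functional_choice _ (fun i => proj2 (Hy i))) as [k Hk].
  destruct (functional_choice _ Hk) as [q Hq]; clear Hk.
  (* The [min] freezes instance [i] at its final state [q i (k i)], which is [y i]. *)
  set (xs := fun t i => q i (min (k i) (steps t i))).
  assert (Hnz : forall t i, steps t i < k i -> xs t i 0 <> 0).
  { intros t i Hlt; unfold xs; rewrite Nat.min_r by lia.
    destruct (Hq i) as [_ [[_ [_ Hnz]] _]]; now apply Hnz. }
  assert (Hz : forall t i, k i <= steps t i -> xs t i = y i /\ xs t i 0 = 0).
  { intros t i Hle; unfold xs; rewrite Nat.min_l by lia.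
    destruct (Hq i) as [_ [[_ [Hz _]] Ey]]; now rewrite Ey. }
  assert (Hrun : forall t, L f (Q t (xs t)) (Q (S t) (xs (S t)))).
  { intros t; destruct (Nat.le_gt_cases (k (nfst t)) (steps t (nfst t))) as [Hle | Hlt].
    - replace (xs (S t)) with (xs t); [apply Hstop, Hz, Hle |].
      extensionality i; unfold xs; simpl; fold (steps t i).
      destruct (Nat.eqb_spec i (nfst t)) as [-> |]; [f_equal; lia | reflexivity].
    - replace (xs (S t)) with
        (fun j => if j =? nfst t then q j (S (steps t j)) else xs t j).
      + replace (fun j => if j =? nfst t then q j (S (steps t j)) else xs t j) with
          (fun j => if j =? nfst t then q (nfst t) (S (steps t (nfst t))) else xs t j)
          by (extensionality j; now destruct (Nat.eqb_spec j (nfst t)) as [-> |]).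
        apply Hgo; [now apply Hnz |]; unfold xs; rewrite Nat.min_r by lia.
        now apply (Hq (nfst t)).
      + extensionality i; unfold xs; simpl; fold (steps t i).
        destruct (Nat.eqb_spec i (nfst t)) as [-> |]; [f_equal; lia | reflexivity]. }
  assert (Hx0 : xs 0 = x).
  { extensionality i; unfold xs; rewrite Nat.min_0_r; apply Hq. }
  exists (Q 0 (xs 0)), (Q 0 (xs 0)).
  split; [now rewrite Hx0 | split; [reflexivity | split]].
  { exists (tuple (fun t => Q t (xs t))); apply (inf_loop_iff _ _ Hf).
    exists (fun t => Q t (xs t)); split; [reflexivity | split; [exact Hrun | reflexivity]]. }
  intros r r' E Hr; change (r = r') in E; subst r'.
  apply (inf_loop_iff _ _ Hf) in Hr as [s [Hs0 [Hs ->]]].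
  assert (Es : s = fun t => Q t (xs t)).
  { extensionality t; induction t as [| t IH]; [exact Hs0 |].
    pose proof (Hs t) as Ht; rewrite IH in Ht; exact (L_single_valued Hf Ht (Hrun t)). }
  subst s; exists (tuple y), y; split; [| split; [now apply delta_seq_Baire | exact Hy]].
  exists (tuple (fun t => tuple (xs t))); split.
  { f_equal; extensionality t; rewrite nthB_tuple, HQ, fstB_pair, HDP.
    now rewrite !sndB_pair. }
  exists y; split; [| reflexivity]; intros i; cbv beta.
  assert (Hmin : exists t, xs t i 0 = 0 /\ forall u, u < t -> xs u i 0 <> 0).
  { destruct (steps_unbounded i (k i)) as [t Ht].
    destruct (dec_inh_nat_subset_has_unique_least_element (fun t => xs t i 0 = 0))
      as [u [[Hu Hleast] _]]; [intros; lia | exists t; now apply Hz |].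
    exists u; split; [exact Hu |]; intros v Hv E; specialize (Hleast v E); lia. }
  destruct Hmin as [t [Ht Hmin]].
  exists (pair (const t) (pair (const i) (tuple (fun t => tuple (xs t))))); split.
  - exists (const t), (pair (const i) (tuple (fun t => tuple (xs t)))).
    split; [| split; reflexivity]; eexists; split; [reflexivity |]; rewrite column_tuple.
    now exists t.
  (* An unfinished run shows no 0, so at the time found by the search the instance has reached its
     final state. *)
  - rewrite entry_tuple; symmetry; apply Hz.
    destruct (Nat.le_gt_cases (k i) (steps t i)) as [Hle | Hlt]; [exact Hle |].
    exfalso; exact (Hnz t i Hlt Ht).
Qed.

Theorem corollary21 (F : mvf Baire Baire)
    (hproblem : is_problem F) (hsingle : single_valued F) (hpointed : pointed F) :
  equiv_sW (inf_loop F) (omega F) /\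
  equiv_sW (omega F) (parallelization (diamond F)).
Proof.
  pose proof (inf_loop_le_omega hsingle) as H1.
  pose proof (omega_le_diamond hsingle) as H2.
  pose proof (diamond_le_inf_loop hsingle hpointed) as H3.
  split; split; eauto using le_sW_trans.
Qed.
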